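(* The spaces $\mathcal{M}_{<\omega}$ and $\mathcal{X}_{<\omega}$ are strongly countable-dimensional and infinite-dimensional.
   Context: Dimension: $\dim$ is the covering dimension. A family $\mathcal{U}$ of subsets of a space $X$ has order at most $k$ if every point of $X$ lies in at most $k+1$ distinct elements of $\mathcal{U}$. For a metric space $X$ and an integer $k\ge 0$, $\dim X\le k$ means that every open cover of $X$ has an open refinement that covers $X$ and has order at most $k$. $X$ is finite-dimensional if $\dim X\le k$ for some $k$, and infinite-dimensional otherwise. A space is strongly countable-dimensional if it can be represented as a countable union of finite-dimensional closed subspaces. Distortion: for metric spaces $(X,d_X)$, $(Y,d_Y)$ and a relation $R\subset X\times Y$, $\operatorname{dis} R=\sup\{|d_X(x_1,x_2)-d_Y(y_1,y_2)| : (x_1,y_1),(x_2,y_2)\in R\}$ (with $\operatorname{dis}\emptyset=0$). Gromov-Hausdorff space: a correspondence between $X$ and $Y$ is a relation $R\subset X\times Y$ whose projections to $X$ and to $Y$ are both surjective. The Gromov-Hausdorff distance is $d_{GH}(X,Y)=\frac12\inf_R \operatorname{dis} R$, the infimum over all correspondences $R$ between $X$ and $Y$. $\mathcal{M}$ is the metric space of isometry classes of non-empty compact metric spaces with the metric $d_{GH}$, and $\mathcal{M}_{<\omega}$ is the metric subspace of isometry classes of (non-empty) finite metric spaces. Box metric space: a metric measure space $(X,d_X,\mu_X)$ is a complete separable metric space $(X,d_X)$ with a Borel probability measure $\mu_X$; one always assumes $X=\operatorname{supp}\mu_X$. Two metric measure spaces are mm-isomorphic if there is an isometry $f\colon \operatorname{supp}\mu_X\to\operatorname{supp}\mu_Y$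 (onto) with $f_*\mu_X=\mu_Y$. $\Pi(\mu_X,\mu_Y)$ is the set of couplings, i.e. Borel measures on $X\times Y$ with marginals $\mu_X$ and $\mu_Y$. The box distance is $\square(X,Y)=\min_{\pi\in\Pi(\mu_X,\mu_Y)}\min_{S}\max\{1-\pi(S),\operatorname{dis}S\}$, where $S$ ranges over all closed subsets of $X\times Y$. $\mathcal{X}$ is the metric space of mm-isomorphism classes of metric measure spaces with the metric $\square$, and $\mathcal{X}_{<\omega}$ is the metric subspace of classes of metric measure spaces with finitely many points (i.e. with finite support). *)

(* Defs.v *)
From HB Require Import structures.
From mathcomp Require Import all_boot all_order all_algebra generic_quotient.
From mathcomp Require Import all_classical all_reals all_analysis.

Set Implicit Arguments.
Unset Strict Implicit.
Unset Printing Implicit Defensive.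

Import Order.TTheory GRing.Theory Num.Theory.
Import numFieldNormedType.Exports.

Local Open Scope classical_set_scope.
Local Open Scope ring_scope.

Section CoveringDimension.
Variable T : topologicalType.

Definition open_cover (U : set (set T)) :=
  U `<=` open /\ \bigcup_(A in U) A = [set: T].

Definition refines (V U : set (set T)) :=
  forall B, V B -> exists2 A, U A & B `<=` A.

Definition order_le (U : set (set T)) (k : nat) :=
  forall x, ([set A | U A /\ A x] #<= `I_k.+1)%card.

Definition dim_le (k : nat) :=
  forall U, open_cover U ->
    exists V, [/\ open_cover V, refines V U & order_le V k].

Definition finite_dimensional := exists k, dim_le k.

Definition infinite_dimensional := ~ finite_dimensional.

End CoveringDimension.

Definition strongly_countable_dimensional (T : topologicalType) :=
  exists F : nat -> set T,
    [/\ forall n, closed (F n),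
        forall n, finite_dimensional (set_type (F n)) &
        \bigcup_n F n = [set: T]].

(** [dist_space d] is [T] with the topology of the metric [d]: a set is open
    when it contains a [d]-ball around each of its points.  The construction
    makes sense, and is a topology, without using that [d] is a metric. *)
Definition dist_space (R : realType) (T : choiceType) (d : T -> T -> R) : Type :=
  T.

Section DistSpace.
Variables (R : realType) (T : choiceType) (d : T -> T -> R).

Definition dist_open (U : set T) :=
  forall x, U x -> exists2 e, 0 < e & [set y | d x y < e] `<=` U.

Let dist_openT : dist_open setT.
Proof. by move=> x _; exists 1. Qed.

Let dist_openI : setI_closed dist_open.
Proof.
move=> A B oA oB x [/oA[a a0 aA] /oB[b b0 bB]].
exists (Num.min a b); first by rewrite lt_min a0.
by move=> y /=; rewrite lt_min => /andP[ya yb]; split; [exact: aA|exact: bB].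
Qed.

Let dist_open_bigU (I : Type) (f : I -> set T) :
  (forall i, dist_open (f i)) -> dist_open (\bigcup_i f i).
Proof.
move=> of_ x [i _ /of_[e e0 ef]]; exists e => // y /ef fy.
by exists i.
Qed.

HB.instance Definition _ := Choice.on (dist_space d).
HB.instance Definition _ :=
  isOpenTopological.Build (dist_space d) dist_openT dist_openI dist_open_bigU.

End DistSpace.

(** This is a record over a bare [Type] rather than [metricType R], because the
    isometry classes of these spaces must in turn carry a [topologicalType]
    structure: the carriers have to live in a universe strictly below the one
    of the types that the library equips with a topology.  In particular a
    finite carrier is to be written [{i : nat | (i < n)%N}], not ['I_n]. *)
Record metricSpace (R : realType) := MetricSpace {
  carrier :> Type;
  dist : carrier -> carrier -> R;
  carrier_inhabited : inhabited carrier;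
  distxx : forall x, dist x x = 0;
  dist_eq0 : forall x y, dist x y = 0 -> x = y;
  distC : forall x y, dist x y = dist y x;
  dist_triangle : forall y x z, dist x z <= dist x y + dist y z }.

Section MetricSpaceInstances.
Variables (R : realType) (X : metricSpace R).

Definition carrier_point : X :=
  projT1 (cid (let: inhabits x := carrier_inhabited X in
               ex_intro (fun=> True) x I)).

HB.instance Definition _ := gen_eqMixin (carrier X).
HB.instance Definition _ := gen_choiceMixin (carrier X).
HB.instance Definition _ := isPointed.Build (carrier X) carrier_point.
HB.instance Definition _ := isMetric.Build R (carrier X)
  (@distxx R X) (@dist_eq0 R X) (@distC R X) (@dist_triangle R X).

End MetricSpaceInstances.

Section Distances.
Variable R : realType.
Implicit Types X Y Z : metricSpace R.

Definition isometry X Y (f : X -> Y) :=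
  forall x x', mdist (f x) (f x') = mdist x x'.

Definition onto_isometry X Y (f : X -> Y) :=
  isometry f /\ range f = [set: Y].

(** The point [0] accounts for the convention that the empty relation has
    distortion [0]; it is irrelevant for all other relations. *)
Definition distortion X Y (S : set (X * Y)) : \bar R :=
  ereal_sup (0%E |`
    [set `|mdist p.1 q.1 - mdist p.2 q.2|%:E | p in S & q in S]).

Definition correspondence X Y (S : set (X * Y)) :=
  fst @` S = [set: X] /\ snd @` S = [set: Y].

Definition gh_dist X Y : \bar R :=
  ((2^-1)%:E * ereal_inf (@distortion X Y @` @correspondence X Y))%E.

Lemma isometry_refl X : onto_isometry (@id X).
Proof. by split=> //; rewrite image_id. Qed.

Lemma isometry_comp X Y Z (f : X -> Y) (g : Y -> Z) :
  onto_isometry f -> onto_isometry g -> onto_isometry (g \o f).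
Proof.
move=> [fi fo] [gi go]; split; first by move=> x x' /=; rewrite gi fi.
rewrite -subTset => z _; have : range g z by rewrite go.
move=> [y _ <-]; have : range f y by rewrite fo.
by move=> [x _ <-]; exists x.
Qed.

Lemma isometry_inv X Y (f : X -> Y) : onto_isometry f ->
  exists g : Y -> X, [/\ onto_isometry g, cancel f g & cancel g f].
Proof.
move=> [fi fo]; have fsurj y : exists x, f x = y.
  by have : [set: Y] y by []; rewrite -fo => -[x _ <-]; exists x.
have [g fK] := choice fsurj.
have gK : cancel f g.
  by move=> x; apply: mdist_positivity; rewrite -fi fK mdistxx.
exists g; split=> //; split; first by move=> y y'; rewrite -fi !fK.
by rewrite -subTset => x _; exists (f x).
Qed.

Lemma isometry_continuous X Y (f : X -> Y) : isometry f -> continuous f.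
Proof.
move=> fi x U /nbhs_ballP[e e0 eU]; apply/nbhs_ballP; exists e => // x' xx'.
by apply: eU; move: xx'; rewrite !ballEmdist /= fi.
Qed.

End Distances.

Section GromovHausdorff.
Variable R : realType.

Record compactMetricSpace := CompactMetricSpace {
  compact_space :> metricSpace R;
  compact_spaceP : compact [set: compact_space] }.

HB.instance Definition _ := gen_eqMixin compactMetricSpace.
HB.instance Definition _ := gen_choiceMixin compactMetricSpace.

Definition isometric (X Y : compactMetricSpace) :=
  `[< exists f : X -> Y, onto_isometry f >].

Let isometric_equiv : equiv_class_of isometric.
Proof.
split.
- by move=> X; apply/asboolP; exists id; exact: isometry_refl.
- suff sym X Y : isometric X Y -> isometric Y X.
    by move=> X Y; apply/idP/idP; exact: sym.
  by move=> /asboolP[f /isometry_inv[g [? _ _]]]; apply/asboolP; exists g.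
- move=> Y X Z /asboolP[f fP] /asboolP[g gP].
  by apply/asboolP; exists (g \o f); exact: isometry_comp.
Qed.

Canonical isometric_equivRel := EquivRelPack isometric_equiv.

Definition GHSpace := {eq_quot isometric_equivRel}%qT.

HB.instance Definition _ := Choice.on GHSpace.
HB.instance Definition _ := Quotient.on GHSpace.

(** [gh_dist] is finite on compact spaces, and depends only on the isometry
    classes of its arguments. *)
Definition gh_metric (a b : GHSpace) : R := fine (gh_dist (repr a) (repr b)).

Definition GHfin : set GHSpace :=
  [set a | exists2 X : compactMetricSpace,
             finite_set [set: X] & a = (\pi_GHSpace X)%qT].

Definition GHfin_space :=
  dist_space (fun a b : set_type GHfin => gh_metric (val a) (val b)).

HB.instance Definition _ := Topological.on GHfin_space.

End GromovHausdorff.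

Notation borel T := (g_sigma_algebraType (@open T)).

Section Box.
Variable R : realType.

Record mmSpace := MMSpace {
  mm_space :> metricSpace R;
  mm_complete : forall F : set_system mm_space,
    ProperFilter F -> cauchy F -> cvg F;
  mm_separable : exists2 D : set mm_space, countable D & dense D;
  mm_measure : probability (borel mm_space) R;
  mm_full_support : forall (x : mm_space) (U : set mm_space),
    open U -> U x -> (0 < mm_measure U)%E }.

HB.instance Definition _ := gen_eqMixin mmSpace.
HB.instance Definition _ := gen_choiceMixin mmSpace.

(** As [X] and [Y] are the supports of their measures, the isometry is defined
    on all of [X], with image [Y]. *)
Definition mm_isomorphism (X Y : mmSpace) (f : X -> Y) :=
  onto_isometry f /\
  forall B : set (borel Y), measurable B ->
    mm_measure Y B = pushforward (mm_measure X) (f : borel X -> borel Y) B.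

Definition mm_isomorphic (X Y : mmSpace) :=
  `[< exists f : X -> Y, mm_isomorphism f >].

Lemma isometry_measurable (X Y : metricSpace R) (f : X -> Y) :
  isometry f -> measurable_fun [set: borel X] (f : borel X -> borel Y).
Proof.
move=> fi; apply: (@measurability _ _ (borel X) (borel Y) setT f (@open Y)).
  by [].
move=> _ [U oU <-]; rewrite setTI; apply: sub_sigma_algebra.
by move/continuousP : (isometry_continuous fi); exact.
Qed.

Let mm_isomorphic_equiv : equiv_class_of mm_isomorphic.
Proof.
split.
- by move=> X; apply/asboolP; exists id; split=> //; exact: isometry_refl.
- suff sym X Y : mm_isomorphic X Y -> mm_isomorphic Y X.
    by move=> X Y; apply/idP/idP; exact: sym.
  move=> /asboolP[f [fi fmu]]; have [g [gi fK gK]] := isometry_inv fi.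
  apply/asboolP; exists g; split=> // B mB.
  have mgB : measurable (g @^-1` B : set (borel Y)).
    by rewrite -[X in measurable X]setTI; apply: (isometry_measurable gi.1).
  rewrite /pushforward fmu// /pushforward; congr (mm_measure X _).
  by apply/seteqP; split=> x /=; rewrite fK.
- move=> Y X Z /asboolP[f [fi fmu]] /asboolP[g [gi gmu]].
  apply/asboolP; exists (g \o f); split; first exact: isometry_comp.
  move=> B mB; rewrite gmu// /pushforward fmu//.
  by rewrite -[X in measurable X]setTI; apply: (isometry_measurable gi.1).
Qed.

Canonical mm_isomorphic_equivRel := EquivRelPack mm_isomorphic_equiv.

Definition coupling (X Y : mmSpace) (p : probability (borel (X * Y)%type) R) :=
  (forall A : set (borel X), measurable A ->
     pushforward p (fst : borel (X * Y)%type -> borel X) A = mm_measure X A) /\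
  (forall B : set (borel Y), measurable B ->
     pushforward p (snd : borel (X * Y)%type -> borel Y) B = mm_measure Y B).

(** The outer and inner minima of the usual formula, which are attained, are
    merged into a single infimum. *)
Definition box_dist (X Y : mmSpace) : \bar R :=
  ereal_inf [set maxe (1 - s.1 s.2)%E (distortion s.2) |
    s in [set s : probability (borel (X * Y)%type) R * set (X * Y) |
           coupling s.1 /\ closed s.2]].

Definition BoxSpace := {eq_quot mm_isomorphic_equivRel}%qT.

HB.instance Definition _ := Choice.on BoxSpace.
HB.instance Definition _ := Quotient.on BoxSpace.

(** [box_dist] takes values in [[0, 1]], and depends only on the
    mm-isomorphism classes of its arguments. *)
Definition box_metric (a b : BoxSpace) : R := fine (box_dist (repr a) (repr b)).

Definition Boxfin : set BoxSpace :=
  [set a | exists2 X : mmSpace,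
             finite_set [set: X] & a = (\pi_BoxSpace X)%qT].

Definition Boxfin_space :=
  dist_space (fun a b : set_type Boxfin => box_metric (val a) (val b)).

HB.instance Definition _ := Topological.on Boxfin_space.

End Box.

(* Main.v *)
Require Import Defs.
From Stdlib Require List.
From mathcomp Require Import all_boot all_order all_algebra.
From mathcomp Require Import all_classical all_reals all_analysis.
From mathcomp Require Import ring lra.

Set Implicit Arguments.
Unset Strict Implicit.
Unset Printing Implicit Defensive.

Import Order.TTheory GRing.Theory Num.Theory.
Import numFieldNormedType.Exports.

Local Open Scope classical_set_scope.
Local Open Scope ring_scope.

(** Both spaces are metric spaces of classes of finite spaces with a positive
    weight on every point (the constant 1, resp. the mass).  Call two of them
    [e]-akin if a bijection changes distances and weights by less than [e].  Let
    [F m] be the set of the spaces with at most [m + 1] points and distances and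
    weights at least [1 / (m + 1)].  Then [F m] is closed, its topology is the one
    given by the relations of being [e]-akin, and it is doubling for them, as a space
    that is [4 r]-akin to a given one is described up to [r] by rounded distances
    and weights.  A cover of [F m] is refined by balls of radius comparable to the
    size of the cover, centred at a maximal separated set; doubling bounds the
    order.

    The space contains, for every [n], a cube [[0, 1]^n] of ultrametric spaces
    inside some [F m].  An open cover of the space by sets that are small on [F m],
    of order less than [n], would restrict to a cover of the cube in which no
    member meets two opposite faces, against the Lebesgue covering theorem, which
    follows from Sperner's lemma for the Kuhn triangulation. *)

(** * Sums modulo 2 and the coboundary of a labelled list *)

Lemma sum_bool_exists (I : eqType) (r : seq I) (Q : pred I) (F : I -> bool) :
  \sum_(i <- r | Q i) F i -> exists2 i, i \in r & Q i && F i.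
Proof.
move=> S1; apply: contrapT => nex; move: S1.
rewrite big1_seq // => i /andP[Qi ir].
by apply/negbTE/negP => Fi; apply: nex; exists i => //; rewrite Qi.
Qed.

(** Sums of booleans are taken in [Z/2]. *)
Fixpoint coboundary (T : Type) (g : seq T -> bool) (l : seq T) : bool :=
  if l is v :: l' then g l' + coboundary (fun l => g (v :: l)) l' else 0.

Lemma coboundaryE (T : Type) (g : seq T -> bool) (l : seq T) :
  coboundary g l = \sum_(0 <= i < size l) g (take i l ++ drop i.+1 l).
Proof.
elim: l g => [|v l IHl] g /=; first by rewrite big_nil.
by rewrite big_nat_recl//= drop0 IHl.
Qed.

Lemma coboundary_map (T U : Type) (f : T -> U) (g : seq U -> bool) (l : seq T) :
  coboundary (fun l => g (map f l)) l = coboundary g (map f l).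
Proof. by elim: l g => //= v l IHl g; rewrite -(IHl (fun l => g (f v :: l))). Qed.

Lemma sum_nth_eq (s : seq nat) x :
  \sum_(0 <= i < size s) (nth 0%N s i == x) = odd (count_mem x s).
Proof.
rewrite -(big_nth 0%N xpredT (fun y => y == x)).
by elim: s => [|y s IHs] /=; rewrite ?big_nil// big_cons IHs oddD oddb.
Qed.

Lemma not_uniq_count (T : eqType) (s : seq T) :
  ~~ uniq s -> exists x, (1 < count_mem x s)%N.
Proof.
move=> /negP ns; apply: contrapT => nex; apply: ns; apply: count_mem_uniq => x.
have : (count_mem x s <= 1)%N by rewrite leqNgt; apply/negP => ?; apply: nex; exists x.
by rewrite -has_pred1 has_count; case: (count_mem x s) => [|[]].
Qed.

(* A list of [k.+1] labels at most [k] with a repetition loses it by the removal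
   of exactly two of its entries, which leaves equal multisets. *)
Lemma coboundary_perm_iota k (s : seq nat) :
  size s = k.+1 -> all (fun i => i <= k)%N s ->
  coboundary (fun s => perm_eq s (iota 0 k)) s = perm_eq s (iota 0 k.+1).
Proof.
move=> sk sle; rewrite coboundaryE; pose cut i := take i s ++ drop i.+1 s.
have cutP i : (i < size s)%N -> perm_eq s (nth 0%N s i :: cut i).
  move=> ilt; rewrite -{1}(cat_take_drop i s) (drop_nth 0%N)//.
  by rewrite -(cat1s _ (cut i)) perm_sym perm_catCA.
have iotaS : perm_eq (iota 0 k.+1) (k :: iota 0 k).
  by rewrite -addn1 iotaD -cat1s perm_catC.
case: (boolP (uniq s)) => [us|ns].
  have ps : perm_eq s (k :: iota 0 k).
    rewrite -(permPr iotaS).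
    have sub : {subset s <= iota 0 k.+1} by move=> i /(allP sle); rewrite mem_iota.
    apply: uniq_perm; rewrite ?iota_uniq//.
    by have [] := uniq_min_size us sub; rewrite size_iota sk.
  rewrite (permPr iotaS) ps -[RHS]/(odd true).
  have -> : true = count_mem k s :> nat.
    by rewrite count_uniq_mem// (perm_mem ps) mem_head.
  rewrite -sum_nth_eq; apply: eq_big_nat => i /= ilt.
  have : perm_eq (nth 0%N s i :: cut i) (k :: iota 0 k) by rewrite -(permPl (cutP _ ilt)).
  case: eqP => [->|ne p]; first by rewrite perm_cons.
  apply/negP => q; apply: ne.
  have : perm_eq (k :: iota 0 k) (nth 0%N s i :: iota 0 k).
    by rewrite -(permPl p) perm_cons.
  by move=> /perm_mem/(_ k); rewrite !inE eqxx mem_iota /= add0n ltnn orbF => /esym/eqP->.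
have -> : perm_eq s (iota 0 k.+1) = false.
  by apply/negP => /perm_uniq; rewrite iota_uniq (negbTE ns).
have [x x2] := not_uniq_count ns.
apply/negP => S1; have /sum_bool_exists[r] := S1.
rewrite mem_index_iota /= => rs Fr.
have countx : count_mem x s = ((nth 0 s r == x) + count_mem x (iota 0 k))%N.
  rewrite (permP (cutP _ rs)) /=; congr (_ + _)%N.
  by apply: (permP (_ : perm_eq (cut r) _)).
move: (x2); rewrite countx count_uniq_mem ?iota_uniq//.
case: eqP => [rx|_]; last by case: (_ \in _).
case xk : (x \in iota 0 k) => // _.
have odd2 : odd (count_mem x s) = false.
  by rewrite countx count_uniq_mem ?iota_uniq// rx eqxx xk.
apply: (elimF idP _ S1).
rewrite -odd2 -sum_nth_eq; apply: eq_big_nat => i /= ilt.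
apply/idP/eqP => [Fi|ix].
  have : count_mem x s = ((nth 0 s i == x) + count_mem x (iota 0 k))%N.
    rewrite (permP (cutP _ ilt)) /=; congr (_ + _)%N.
    by apply: (permP (_ : perm_eq (cut i) _)).
  by rewrite countx => /addIn; rewrite rx eqxx; case: eqP.
have : perm_eq (nth 0%N s i :: cut i) (nth 0%N s r :: cut r).
  by rewrite -(permPl (cutP _ ilt)) (permPl (cutP _ rs)).
by rewrite ix rx perm_cons => /permPl->.
Qed.

(** * Sperner's lemma for the Kuhn triangulation of a cubical grid *)

Section KuhnSperner.
Implicit Types (v w : nat -> nat) (P : pred nat) (l : seq (nat -> nat)).
Implicit Types (g h : seq (nat -> nat) -> bool).
Variables D N : nat.

Definition incr j v := fun i => (v i + (i == j))%N.

Definition set_at d a v := fun i => if i == d then a else v i.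

Definition remove j P : pred nat := fun i => (i != j) && P i.

(** [chain_sum n v P g] sums [g] over the chains of [n] unit steps from [v] in
    distinct directions taken from [P]. *)
Fixpoint chain_sum n v P g : bool :=
  if n is n'.+1 then
    \sum_(j <- iota 0 D | P j)
      chain_sum n' (incr j v) (remove j P) (fun l => g (v :: l))
  else g [:: v].

Definition in_cube v P w := forall i, (v i <= w i <= v i + P i)%N.

Lemma chain_sumD n v P g h :
  chain_sum n v P (fun l => g l + h l) = chain_sum n v P g + chain_sum n v P h.
Proof.
elim: n v P g h => //= n IHn v P g h; rewrite -big_split /=.
by apply: eq_bigr => j _; rewrite IHn.
Qed.

Lemma chain_sum_exists n v P g : chain_sum n v P g ->
  exists l, [/\ size l = n.+1, List.Forall (in_cube v P) l & g l].
Proof.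
elim: n v P g => [|n IHn] v P g /=.
  move=> gv; exists [:: v]; split=> //; constructor => // i.
  by rewrite leqnn leq_addr.
move=> /sum_bool_exists[j _ /andP[Pj /IHn[l [sl Fl gl]]]].
exists (v :: l); split=> //=; first by rewrite sl.
constructor; first by move=> i; rewrite leqnn leq_addr.
apply: List.Forall_impl Fl => w + i => /(_ i); rewrite /incr /remove.
case: eqP => [->|_] /=; last by rewrite addn0.
by rewrite Pj addn0 => /andP[le1 ->]; rewrite andbT (leq_trans _ le1) ?leq_addr.
Qed.

(** Unequal totals have sum 1 in [Z/2], and [chain_sum_exists] then yields a chain on which [g] and
    [h] differ. *)
Lemma eq_chain_sum n v P g h :
  (forall l, size l = n.+1 -> List.Forall (in_cube v P) l -> g l = h l) ->
  chain_sum n v P g = chain_sum n v P h.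
Proof.
move=> gh; apply/eqP/negPn/negP => neq.
have /chain_sum_exists[l [sl Fl]] : chain_sum n v P (fun l => g l + h l).
  by rewrite chain_sumD; move: neq; case: chain_sum; case: chain_sum.
by rewrite gh// [_ + _]addbb.
Qed.

Lemma chain_sum_eq0 n v P g :
  (forall l, size l = n.+1 -> List.Forall (in_cube v P) l -> g l = false) ->
  chain_sum n v P g = 0.
Proof.
move=> g0; apply/negbTE/negP => /chain_sum_exists[l [sl Fl]].
by rewrite g0.
Qed.

Lemma incrC i j v : incr i (incr j v) = incr j (incr i v).
Proof. by apply/funext => k; rewrite /incr addnAC. Qed.

Lemma removeC i j P : remove i (remove j P) = remove j (remove i P).
Proof. by apply/funext => k; rewrite /remove andbCA. Qed.

(* The pairs (i, j) and (j, i) of directions cancel. *)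
Lemma sum_offdiag_symmetric (P : pred nat) (F : nat -> nat -> bool) :
  (forall i j, F i j = F j i) ->
  \sum_(j <- iota 0 D | P j) \sum_(i <- iota 0 D | remove j P i) F i j = 0.
Proof.
move=> Fsym.
have splitF j : P j -> \sum_(i <- iota 0 D | remove j P i) F i j =
    \sum_(i <- iota 0 D | P i && (i < j)%N) F i j +
    \sum_(i <- iota 0 D | P i && (j < i)%N) F i j.
  move=> Pj; rewrite (bigID (fun i => i < j)%N) /=.
  congr (_ + _); apply: eq_bigl => i; rewrite /remove.
    by case: (P i); case: ltngtP.
  by case: (P i); case: ltngtP.
rewrite (eq_bigr _ splitF) big_split /=.
rewrite [X in _ + X](exchange_big_dep P) /=; last by move=> i j _ /andP[].
have -> (x y : bool) : x = y -> x + y = 0 by move=> ->; exact: addbb.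
- by [].
- apply: eq_bigr => j Pj.
  by apply: eq_big => i; [rewrite Pj | rewrite Fsym].
Qed.

(* The boundary of the Kuhn triangulation of a cube is the union of the Kuhn
   triangulations of its facets. *)
Lemma chain_sum_coboundary n v P g :
  chain_sum n.+1 v P (coboundary g) =
  \sum_(j <- iota 0 D | P j) (chain_sum n (incr j v) (remove j P) g +
                              chain_sum n v (remove j P) g).
Proof.
elim: n v P g => [|n IHn] v P g.
  by apply: eq_bigr => j _ /=; rewrite addr0.
have -> : chain_sum n.+2 v P (coboundary g) = \sum_(j <- iota 0 D | P j)
    (chain_sum n.+1 (incr j v) (remove j P) g +
     chain_sum n.+1 (incr j v) (remove j P) (coboundary (fun l => g (v :: l)))).
  by apply: eq_bigr => j _; rewrite -chain_sumD.
rewrite !big_split; congr (_ + _).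
rewrite (eq_bigr _ (fun j _ => IHn (incr j v) (remove j P) _)).
rewrite (eq_bigr _ (fun j _ => big_split _ _ _ _ _)) big_split /=.
(* The symmetric half collects the faces without the second vertex: each is shared by the two chains
   that make the first two steps in either order. *)
rewrite sum_offdiag_symmetric ?add0r; last first.
  by move=> i j; rewrite incrC removeC.
rewrite [LHS](exchange_big_dep P) /=; last by move=> i j _ /andP[].
apply: eq_bigr => j Pj; apply: eq_big => i.
  by rewrite /remove Pj andbT eq_sym andbC.
by move=> _; rewrite removeC.
Qed.

Fixpoint box_sum d (F : (nat -> nat) -> bool) : bool :=
  if d is d'.+1 then \sum_(0 <= a < N) box_sum d' (fun v => F (set_at d' a v))
  else F (fun=> 0%N).

Definition in_box d v :=
  (forall i, i < d -> v i < N)%N /\ (forall i, d <= i -> v i = 0)%N.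

Lemma box_sumD d F G :
  box_sum d (fun v => F v + G v) = box_sum d F + box_sum d G.
Proof.
elim: d F G => //= d IHd F G; rewrite -big_split /=.
by apply: eq_bigr => j _; rewrite IHd.
Qed.

Lemma in_box_set_at d a v : (a < N)%N -> in_box d v -> in_box d.+1 (set_at d a v).
Proof.
move=> aN [vN v0]; split=> i; rewrite /set_at; case: eqP => // /eqP ne.
- by rewrite ltnS leq_eqVlt (negbTE ne) => /vN.
- by move: ne => /[swap] di; rewrite gtn_eqF.
- by move=> di; rewrite v0// ltnW.
Qed.

Lemma box_sum_exists d F : box_sum d F -> exists2 v, in_box d v & F v.
Proof.
elim: d F => [|d IHd] F /=; first by move=> F0; exists (fun=> 0%N).
move=> /sum_bool_exists[a]; rewrite mem_index_iota /= => aN /IHd[v vd Fv].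
by exists (set_at d a v) => //; exact: in_box_set_at.
Qed.

Lemma eq_box_sum d F G : (forall v, in_box d v -> F v = G v) ->
  box_sum d F = box_sum d G.
Proof.
move=> FG; apply/eqP/negPn/negP => neq.
have /box_sum_exists[v vd] : box_sum d (fun v => F v + G v).
  by rewrite box_sumD; move: neq; case: box_sum; case: box_sum.
by rewrite FG// [_ + _]addbb.
Qed.

Lemma box_sum_eq0 d F : (forall v, in_box d v -> F v = 0) -> box_sum d F = 0.
Proof. by move=> F0; apply/negbTE/negP => /box_sum_exists[v /F0->]. Qed.

Lemma box_sum_sum d (r : seq nat) (Q : pred nat) (F : nat -> (nat -> nat) -> bool) :
  box_sum d (fun v => \sum_(j <- r | Q j) F j v) = \sum_(j <- r | Q j) box_sum d (F j).
Proof.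
elim: d F => //= d IHd F; rewrite exchange_big /=.
by apply: eq_bigr => a _; rewrite IHd.
Qed.

(** Along the last coordinate the sum telescopes to the values at heights [N] and [0], as signs do
    not matter in [Z/2]; those at [N] vanish by hypothesis. *)
Lemma box_sum_telescope_last d H :
  (forall v, in_box d v -> H (set_at d N v) = 0) ->
  box_sum d.+1 (fun v => H (incr d v) + H v) = box_sum d H.
Proof.
move=> HN; pose G a := box_sum d (fun v => H (set_at d a v)).
have GN : G N = 0 by apply: box_sum_eq0.
have G0 : G 0%N = box_sum d H.
  apply: eq_box_sum => v [_ v0]; congr H; apply/funext => i; rewrite /set_at.
  by case: eqP => // ->; rewrite v0.
rewrite /= (eq_bigr (fun a => G a.+1 - G a)).
  by rewrite telescope_sumr// GN G0 add0r.
move=> a _; rewrite box_sumD; congr (_ + _); apply: eq_box_sum => v _.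
congr H; apply/funext => i; rewrite /incr /set_at.
by case: eqP => _; rewrite ?addn1 ?addn0.
Qed.

(** When [H] counts on the facets orthogonal to direction [j], an inner facet is counted by the
    cubes on both sides of it and cancels; on the two outer hyperplanes [H] is zero. *)
Lemma box_sum_telescope d j H : (j < d)%N ->
  (forall v, (forall i, i < d -> i != j -> v i < N)%N ->
     (forall i, d <= i -> v i = 0)%N -> v j = 0%N \/ v j = N -> H v = 0) ->
  box_sum d (fun v => H (incr j v) + H v) = 0.
Proof.
elim: d j H => // d IHd j H; rewrite ltnS leq_eqVlt => /predU1P[->|jd] H0.
  rewrite box_sum_telescope_last => [|v [vN v0]].
    apply: box_sum_eq0 => v [vN v0]; apply: H0.
    - by move=> i; rewrite ltnS leq_eqVlt => /predU1P[->|/vN//]; rewrite eqxx.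
    - by move=> i /ltnW/v0.
    - by left; rewrite v0.
  apply: H0 => [i|i di|]; rewrite /set_at.
  - by rewrite ltnS leq_eqVlt => /predU1P[->|/vN]; case: eqP.
  - by rewrite gtn_eqF// v0// ltnW.
  - by right; rewrite eqxx.
rewrite /= big1_seq// => a; rewrite mem_index_iota /= => aN.
rewrite -[RHS](IHd j (fun v => H (set_at d a v)))//.
  apply: eq_box_sum => v _; congr (H _ + _); apply/funext => i.
  rewrite /incr /set_at; case: (i =P d) => // ->.
  by rewrite gtn_eqF// addn0.
move=> v vN v0 vj; apply: H0; rewrite /set_at.
- move=> i; rewrite ltnS leq_eqVlt; case: eqP => //= _; exact: vN.
- by move=> i di; rewrite gtn_eqF// v0// ltnW.
- by rewrite ltn_eqF.
Qed.

Definition in_grid w := (forall i, w i <= N)%N /\ (forall i, D <= i -> w i = 0)%N.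

Lemma in_cube_grid d v P w : (d <= D)%N -> {subset P <= gtn d} ->
  (forall i, i < d -> v i + P i <= N)%N -> (forall i, d <= i -> v i = 0)%N ->
  in_cube v P w -> in_grid w.
Proof.
move=> dD Pd vN v0 wP.
have w0 i : (d <= i)%N -> w i = 0%N.
  move=> di; move: (wP i); rewrite v0//.
  have /negbTE-> : ~~ P i by apply/negP => /Pd; rewrite inE ltnNge di.
  by rewrite leqn0 => /eqP.
split=> i; last by move=> Di; exact/w0/(leq_trans dD).
case: (ltnP i d) => [/vN|/w0->//].
by apply: leq_trans; case/andP: (wP i).
Qed.

Lemma Forall_all (Q : (nat -> nat) -> Prop) (p : pred nat) (lam : (nat -> nat) -> nat) l :
  (forall w, Q w -> p (lam w)) -> List.Forall Q l -> all p (map lam l).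
Proof.
move=> Qp; elim: l => //= w l IHl Fl.
by apply/andP; split; [exact/Qp/(List.Forall_inv Fl)|exact/IHl/(List.Forall_inv_tail Fl)].
Qed.

Lemma Forall_mem_map (Q : (nat -> nat) -> Prop) (lam : (nat -> nat) -> nat) l k :
  k \in map lam l -> List.Forall Q l -> exists2 w, Q w & lam w = k.
Proof.
elim: l => //= w l IHl; rewrite inE => /predU1P[->|kl] Fl.
  by exists w => //; exact: List.Forall_inv Fl.
by apply: IHl => //; exact: List.Forall_inv_tail Fl.
Qed.

Section Labelling.
Variable lam : (nat -> nat) -> nat.
(** At [j = D], where every grid point has coordinate [0], this bounds all labels by [D]. *)
Hypothesis lam_zero : forall w j, in_grid w -> w j = 0%N -> (lam w <= j)%N.
Hypothesis lam_top : forall w j, in_grid w -> w j = N -> lam w <> j.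

Definition fully_labelled k l := perm_eq (map lam l) (iota 0 k).

(* Among the outer facets only those in the hyperplane of the last coordinate
   [0] can carry all the labels below the dimension. *)
Lemma count_fully_labelled d : (d <= D)%N ->
  box_sum d (fun v => chain_sum d v (gtn d) (fully_labelled d.+1)) = true.
Proof.
elim: d => [|d IHd] dD.
  rewrite /= /fully_labelled /=.
  have : (lam (fun=> 0%N) <= 0)%N by apply: lam_zero.
  by rewrite leqn0 => /eqP->.
pose H j v := chain_sum d v (remove j (gtn d.+1)) (fully_labelled d.+1).
transitivity (box_sum d.+1 (fun v =>
    \sum_(j <- iota 0 D | (j < d.+1)%N) (H j (incr j v) + H j v))).
  (* A simplex is fully labelled exactly when an odd number of its facets carry the labels [0] to
     [d]. This requires labels at most [d.+1], which [lam_zero] gives because coordinate [d.+1] is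
     [0]. *)
  apply: eq_box_sum => v vd; rewrite -chain_sum_coboundary.
  apply: eq_chain_sum => l sl Fl; rewrite /fully_labelled.
  rewrite (coboundary_map lam (fun s => perm_eq s (iota 0 d.+1))).
  rewrite coboundary_perm_iota ?size_map//.
  apply: Forall_all Fl => w wc; apply: lam_zero.
    apply: (in_cube_grid dD) wc => //; last by case: vd.
    by move=> i id; rewrite /= id addn1; case: vd => + _; apply.
  have [_ /(_ _ (leqnn _)) v0] := vd; move: (wc d.+1).
  by rewrite v0 /= ltnn leqn0 => /eqP.
rewrite box_sum_sum big_mkcond (bigD1_seq d) ?iota_uniq ?mem_iota// ltnSn -[LHS]/(_ + _).
(* A facet in the hyperplane [v j = N] lacks the label [j]. *)
have HN v j : (j < d.+1)%N -> (forall i, i < d.+1 -> i != j -> v i < N)%N ->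
    (forall i, d.+1 <= i -> v i = 0)%N -> v j = N -> H j v = 0.
  move=> jd vN v0 vj; apply: chain_sum_eq0 => l _ Fl.
  apply/negP => /perm_mem/(_ j); rewrite [RHS]mem_iota jd.
  move=> /Forall_mem_map-/(_ _ Fl)[w wv]; apply: lam_top.
    apply: (in_cube_grid dD) wv => // [i /andP[]//|i id].
    rewrite /remove /= id andbT; case: eqP => [->|/eqP ij]; first by rewrite vj addn0.
    by rewrite addn1 vN.
  move: (wv j); rewrite /remove eqxx /= vj addn0 -eqn_leq => /eqP<-//.
(* A facet in the hyperplane [v j = 0] with [j < d] has labels at most [j] and lacks the label
   [d]. *)
have H0 v j : (j < d)%N -> (forall i, i < d.+1 -> i != j -> v i < N)%N ->
    (forall i, d.+1 <= i -> v i = 0)%N -> v j = 0%N -> H j v = 0.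
  move=> jd vN v0 vj; apply: chain_sum_eq0 => l _ Fl.
  apply/negP => /perm_mem/(_ d); rewrite [RHS]mem_iota ltnSn.
  move=> /Forall_mem_map-/(_ _ Fl)[w wv] lw.
  suff : (lam w <= j)%N by rewrite lw leqNgt jd.
  apply: lam_zero.
    apply: (in_cube_grid dD) wv => // [i /andP[]//|i id].
    rewrite /remove /= id andbT; case: eqP => [->|/eqP ij]; first by rewrite vj.
    by rewrite addn1 vN.
  by move: (wv j); rewrite /remove eqxx /= vj addn0 leqn0 => /eqP.
rewrite [X in _ + X]big1 => [|j jne]; last first.
  case: ifP => // jd; have {}jd : (j < d)%N by rewrite ltn_neqAle jne.
  apply: box_sum_telescope => [|v vN v0 [vj|vj]]; first exact: ltnW.
    exact: H0.
  by apply: HN => //; exact: ltnW.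
rewrite addr0 box_sum_telescope_last => [|v [vN v0]].
  rewrite -[RHS](IHd (ltnW dD)); apply: eq_box_sum => v _; congr chain_sum.
  by apply/funext => i; rewrite /remove /= ltnS [in RHS]ltn_neqAle.
apply: HN => // [i||]; rewrite /set_at ?eqxx//.
  by rewrite ltnS leq_eqVlt; case: eqP => //= _ /vN.
by move=> i di; rewrite gtn_eqF// v0// ltnW.
Qed.

Theorem kuhn_sperner : exists2 v, in_box D v &
  forall k, (k <= D)%N -> exists2 w, in_cube v (gtn D) w & lam w = k.
Proof.
have := count_fully_labelled (leqnn D).
move=> /box_sum_exists[v vD /chain_sum_exists[l [_ Fl lP]]].
exists v => // k kD; apply: Forall_mem_map Fl.
by rewrite (perm_mem lP) mem_iota.
Qed.

End Labelling.

End KuhnSperner.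

(** * The Lebesgue covering theorem for the unit cube *)

Lemma not_card_le_II (T : Type) (A : set T) n (f : nat -> T) :
  (forall k, (k <= n)%N -> A (f k)) ->
  (forall k l, (k <= n)%N -> (l <= n)%N -> f k = f l -> k = l) ->
  ~ (A #<= `I_n)%card.
Proof.
move=> fA finj le; suff : (`I_n.+1 #<= `I_n)%card by rewrite card_le_II ltnn.
have /card_eqPle[_ le1] : (f @` `I_n.+1 #= `I_n.+1)%card.
  by apply: inj_card_eq => k l; rewrite !inE /= => kn ln; exact: finj.
apply: (card_le_trans le1); apply: card_le_trans le.
by apply: subset_card_le => _ [k /= kn <-]; exact: fA.
Qed.

Section LebesgueCovering.
Variables (R : realType) (D : nat).

Definition unit_cube : set 'rV[R]_D := [set x | forall j, 0 <= x 0 j <= 1].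

Definition cube_close (e : R) (x y : 'rV[R]_D) := forall j, `|x 0 j - y 0 j| < e.

Lemma unit_cube_compact : compact unit_cube.
Proof.
have -> : unit_cube = [set v | forall i, `[0, 1]%classic (v ord0 i)].
  by apply/seteqP; split=> x /= xP j; move: (xP j); rewrite in_itv.
apply: (@rV_compact R D (fun=> `[0, 1]%classic)) => i.
exact: segment_compact.
Qed.

(** The cover is an indexed family, so that the members of a cover of another space can still be
    counted after they are pulled back to the cube. *)
Variables (I : Type) (V : set I) (P : I -> set 'rV[R]_D).
Hypothesis P_cover : forall x, unit_cube x -> exists2 i, V i & P i x.
Hypothesis P_open : forall i x, V i -> unit_cube x -> P i x ->
  exists2 e, 0 < e & forall y, unit_cube y -> cube_close e x y -> P i y.

(** If the [e]-neighbourhood of [x] lies in a member, then so do the [e']-neighbourhoods of all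
    points within [e / 2] of [x], for [e' < e / 2]. Compactness makes [e'] uniform. *)
Lemma lebesgue_number : exists2 e, 0 < e & forall x, unit_cube x ->
  exists2 i, V i & forall y, unit_cube y -> cube_close e x y -> P i y.
Proof.
have [cov _] := compact_near_coveringP unit_cube.
have [] := cov unit_cube_compact R 0^'+ (fun e x => exists2 i, V i &
  forall y, unit_cube y -> cube_close e x y -> P i y).
  move=> x Qx.
  have [i Vi Pix] := P_cover Qx; have [e e0 eP] := P_open Vi Qx Pix.
  exists (ball x (e / 2), [set e' | e' < e / 2]).
    split=> /=; first by apply: nbhsx_ballx; rewrite divr_gt0.
    by apply: nbhs_right_lt; rewrite divr_gt0.
  move=> [x' e'] /= [xx' e'e]; exists i => // y Qy x'y; apply: eP => // j.
  rewrite [e]splitr -(subrK (x' 0 j) (x 0 j)) -addrA.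
  apply: le_lt_trans (ler_normD _ _) _; apply: ltrD; first by case: xx' => _; apply.
  exact: lt_trans (x'y j) e'e.
move=> e /= e0 He; exists (e / 2); first by rewrite divr_gt0.
apply: He; rewrite /= ?divr_gt0// sub0r normrN ger0_norm ?ltW ?divr_gt0//.
by rewrite ltr_pdivrMr// ltr_pMr// ltr1n.
Qed.

Hypothesis P_faces : forall i j x y, V i -> unit_cube x -> unit_cube y ->
  P i x -> P i y -> x 0 j = 0 -> y 0 j = 1 -> False.

(* Label a vertex by the first face x_j = 0 that meets a member of the cover
   around it; the members at a fully labelled simplex are pairwise distinct. *)
Theorem lebesgue_covering :
  exists2 x, unit_cube x & ~ ([set i | V i /\ P i x] #<= `I_D)%card.
Proof.
have [e e0 eP] := lebesgue_number.
pose N := (Num.bound e^-1).+1.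
have N0 : 0 < N%:R :> R by rewrite ltr0n.
have Ne : N%:R^-1 < e.
  rewrite -[e]invrK ltf_pV2 ?posrE ?invr_gt0//.
  apply: lt_le_trans (archi_boundP _) _; first by rewrite invr_ge0 ltW.
  by rewrite ler_nat leqnSn.
pose pt (v : nat -> nat) : 'rV[R]_D := \row_j ((v j)%:R / N%:R).
have pt_cube w : in_grid D N w -> unit_cube (pt w).
  move=> [wN _] j; rewrite mxE divr_ge0 ?ler0n//= ler_pdivrMr// mul1r.
  by rewrite ler_nat.
have [A AP] : exists A : (nat -> nat) -> I, forall w, in_grid D N w ->
    V (A w) /\ forall y, unit_cube y -> cube_close e (pt w) y -> P (A w) y.
  have [|i0 _ _] := eP (pt (fun=> 0%N)); first exact: pt_cube.
  pose good w i := in_grid D N w ->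
    V i /\ forall y, unit_cube y -> cube_close e (pt w) y -> P i y.
  suff /choice[A AP] : forall w, exists i, good w i by exists A.
  move=> w; rewrite /good.
  have [/pt_cube/eP[i Vi iP]|nw] := pselect (in_grid D N w); first by exists i => _; split.
  by exists i0 => /nw.
have APw w : in_grid D N w -> P (A w) (pt w).
  move=> wg; have [_] := AP _ wg; apply; first exact: pt_cube.
  by move=> j; rewrite subrr normr0.
pose q i k := `[< exists2 j : 'I_D, val j = k &
                   exists2 x, unit_cube x & P i x /\ x 0 j = 0 >].
(* If no such face is met, [find] returns the length of the list, so the label is [D]. *)
pose lab i := find (q i) (iota 0 D).
have [w j wg wj|w j wg wj|v [vN v0] vP] := @kuhn_sperner D N (lab \o A).
- rewrite leqNgt; apply/negP => jlt /=.
  have jD : (j < D)%N.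
    by apply: leq_trans jlt _; rewrite -[leqRHS](size_iota 0 D) find_size.
  have := before_find 0%N jlt; rewrite nth_iota// add0n => /asboolP; apply.
  exists (Ordinal jD) => //; exists (pt w); first exact: pt_cube.
  by split; [exact: APw|rewrite mxE /= wj mul0r].
(* A member labelled [j < D] meets the face [x_j = 0], so by [P_faces] it cannot contain a grid
   point on the opposite face. *)
- move=> lj; case: (ltnP j D) => [jD|Dj]; last first.
    by case: wg => _ /(_ _ Dj); rewrite wj.
  have /(nth_find 0%N) : has (q (A w)) (iota 0 D).
    by rewrite has_find -/(lab _) [lab _]lj size_iota.
  rewrite -/(lab _) [lab _]lj nth_iota// add0n => /asboolP[j' j'j [x Qx [Px xj]]].
  apply: (@P_faces (A w) j' x (pt w)) => //; first by case: (AP _ wg).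
  - exact: pt_cube.
  - exact: APw.
  - by rewrite mxE j'j wj divff// gt_eqF.
have vg : in_grid D N v.
  by split=> // i; case: (ltnP i D) => [/vN/ltnW|/v0->].
exists (pt v); first exact: pt_cube.
(* All vertices of the grid cube at [v] are within [1/N < e] of [pt v], so the members chosen at the
   vertices with labels [0] to [D] all contain [pt v]. *)
have [w wP] : exists w : nat -> nat -> nat, forall k, (k <= D)%N ->
    [/\ in_grid D N (w k), lab (A (w k)) = k & P (A (w k)) (pt v)].
  pose good k w := (k <= D)%N ->
    [/\ in_grid D N w, lab (A w) = k & P (A w) (pt v)].
  suff /choice[w wP] : forall k, exists w, good k w by exists w.
  move=> k; rewrite /good.
  case: (leqP k D) => [/vP[w wv lw]|kD]; last by exists v.
  exists w => _.
  have wg : in_grid D N w.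
    apply: (in_cube_grid (leqnn D)) wv => // i iD.
    by rewrite /= iD addn1 vN.
  split=> //; have [_] := AP _ wg; apply; first exact: pt_cube.
  move=> j; rewrite !mxE -mulrBl normrM (@ger0_norm _ N%:R^-1) ?invr_ge0 ?ler0n//.
  apply: le_lt_trans Ne; rewrite ler_piMl ?invr_ge0 ?ler0n//.
  have /andP[le1 le2] := wv j; rewrite -natrB// ger0_norm ?ler0n// lern1.
  by rewrite leq_subLR (leq_trans le2)// leq_add2l leq_b1.
apply: (@not_card_le_II _ _ _ (A \o w)) => [k kD|k l kD lD /= Akl].
  by have [/AP[VA _] _] := wP k kD.
have [_ <- _] := wP k kD; have [_ <- _] := wP l lD.
by rewrite Akl.
Qed.

End LebesgueCovering.

(** * Finite dimension from a doubling condition *)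

Lemma card_le_II_inj (T : Type) (A : set T) n (f : T -> nat) :
  (forall x, A x -> (f x < n)%N) ->
  (forall x y, A x -> A y -> f x = f y -> x = y) -> (A #<= `I_n)%card.
Proof.
move=> fn finj; have /card_eqPle[_ le1] : (f @` A #= A)%card.
  by apply: inj_card_eq => x y; rewrite !inE; exact: finj.
apply: (card_le_trans le1); apply: subset_card_le => _ [x Ax <-].
exact: fn.
Qed.

Section DoublingDimension.
Variables (R : realType) (T : topologicalType) (near : R -> T -> T -> Prop).
Variable J : nat.
Hypothesis near_refl : forall (e : R) x, 0 < e -> near e x x.
Hypothesis near_sym : forall e x y, near e x y -> near e y x.
Hypothesis near_trans : forall e e' x y z,
  near e x y -> near e' y z -> near (e + e') x z.
Hypothesis near_le : forall e e' x y, e <= e' -> near e x y -> near e' x y.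
Hypothesis near_lt : forall e x y, near e x y -> exists2 e', e' < e & near e' x y.
Hypothesis open_near : forall U : set T, open U <->
  forall x, U x -> exists2 e : R, 0 < e & near e x `<=` U.
(** The doubling condition: the [4 r]-ball around [p] splits into at most [J] parts whose points are
    pairwise [r]-near. *)
Hypothesis near_code : forall p (r : R), 0 < r -> exists c : T -> nat,
  (forall y, c y < J)%N /\
  forall y z, near (4%:R * r) p y -> near (4%:R * r) p z -> c y = c z -> near r y z.

Let half k : R := 2^-1 ^+ k.

Let half_gt0 k : 0 < half k. Proof. by rewrite exprn_gt0// invr_gt0. Qed.

Let half_le k l : (k <= l)%N -> half l <= half k.
Proof. by move=> kl; rewrite ler_wiXn2l// invf_le1// ler1n. Qed.

Let half_double k : half k.+1 + half k.+1 = half k.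
Proof. by rewrite /half exprSr -splitr. Qed.

Section Refinement.
Variable U : set (set T).
Hypothesis U_cover : open_cover U.

Let good x k := exists2 A, U A & near (half k) x `<=` A.

Let good_exists x : exists k, `[< good x k >].
Proof.
have [Uo Uc] := U_cover; have : [set: T] x by [].
rewrite -Uc => -[A UA Ax]; have [e e0 eA] := (open_near A).1 (Uo _ UA) _ Ax.
have [k ke] : exists k, half k < e.
  exists (Num.bound e^-1); rewrite /half exprVn -[ltRHS]invrK ltf_pV2 ?posrE ?invr_gt0 ?exprn_gt0//.
  apply: lt_trans (archi_boundP _) _; first by rewrite invr_ge0 ltW.
  by rewrite -natrX ltr_nat ltn_expl.
exists k; apply/asboolP; exists A => // y xy; apply: eA.
exact: near_le (ltW ke) xy.
Qed.

Let k x := ex_minn (good_exists x).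

Let k_good x : good x (k x).
Proof. by rewrite /k; case: ex_minnP => m /asboolP. Qed.

Let k_min x m : good x m -> (k x <= m)%N.
Proof. by rewrite /k; case: ex_minnP => l _ lmin /asboolP; exact: lmin. Qed.

(** The ball of half the radius around [y] stays in the ball [near (half (k x)) x], hence in the
    same member of [U]. *)
Let k_near x y : near (half (k x).+1) x y -> (k y <= (k x).+1)%N.
Proof.
move=> xy; apply: k_min; have [A UA xA] := k_good x; exists A => // z yz.
by apply: xA; rewrite -half_double; exact: near_trans yz.
Qed.

(** With a quarter of [half (k x)], the exponents [k] of a centre and of a point [p] of its ball
    differ by at most one, so that all balls through [p] have radii between [half (k p).+3] and
    [half (k p).+1]. *)
Let r x := half (k x).+2.

(** Distinct points have to be apart only at the smaller of their two radii. A point outside all the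
    balls [near (r s) s] can therefore be added, and a maximal such set has balls that cover. *)
Definition separated (S : set T) := forall s t, S s -> S t ->
  near (r s) s t -> near (r t) s t -> s = t.

Lemma maximal_separated : exists2 S, separated S &
  forall x, exists2 s, S s & near (r s) s x.
Proof.
have [|S [sepS maxS]] := @Zorn_bigcup T separated.
  move=> F Fsep Ftot s t [A FA As] [B FB Bt].
  have [AB|BA] := Ftot _ _ FA FB.
    by apply: (Fsep B) => //; exact: AB.
  by apply: (Fsep A) => //; exact: BA.
exists S => // x; apply: contrapT => nex.
have Sx s : S s -> ~ near (r s) s x by move=> Ss sx; apply: nex; exists s.
apply: (maxS (x |` S)).
  split; [by move=> y; right|move=> E].
  have : (x |` S) x by left.
  by move=> /E/Sx; apply; exact/near_refl/half_gt0.
move=> s t [->|Ss] [->|St] //; last exact: sepS.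
- by move=> _ /near_sym xt; case: (Sx t).
- by move=> sx; case: (Sx s).
Qed.

Lemma doubling_refinement :
  exists V, [/\ open_cover V, refines V U & order_le V J].
Proof.
have [S sepS covS] := maximal_separated.
exists [set near (r s) s | s in S]; split.
- split.
    move=> _ [s Ss <-]; apply/open_near => y /near_lt[e' e'r sy].
    exists (r s - e'); first by rewrite subr_gt0.
    by move=> z yz; rewrite /= -(subrK e' (r s)) addrC; exact: near_trans yz.
  rewrite -subTset => x _; have [s Ss sx] := covS x.
  by exists (near (r s) s) => //; exists s.
- move=> _ [s Ss <-]; have [A UA sA] := k_good s; exists A => // y sy.
  by apply: sA; apply: near_le sy; exact/half_le/leqW/leqnSn.
(* For [r0 = half (k p).+3], the centres of the balls through [p] are [4 r0]-near to [p] and have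
   radii at least [r0]. *)
- move=> p; have [c [cJ cP]] := @near_code p (half (k p).+3) (half_gt0 _).
  have four : 4%:R * half (k p).+3 = half (k p).+1.
    by rewrite -(half_double (k p).+1) -(half_double (k p).+2); ring.
  have ball_p s : near (r s) s p ->
      near (half (k p).+1) p s /\ half (k p).+3 <= r s.
    move=> sp; have ps : (k p <= (k s).+1)%N.
      by apply: k_near; apply: near_le sp; exact/half_le.
    have near_ps : near (half (k p).+1) p s.
      by apply: near_sym; apply: near_le sp; exact: half_le.
    by split=> //; apply: half_le; rewrite !ltnS; exact: k_near.
  have [f fP] : exists f : set T -> T, forall A,
      [set A | [set near (r s) s | s in S] A /\ A p] A ->
      S (f A) /\ A = near (r (f A)) (f A).
    pose centre A x := [set A | [set near (r s) s | s in S] A /\ A p] A ->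
      S x /\ A = near (r x) x.
    suff /choice[f fP] : forall A, exists x, centre A x by exists f.
    move=> A; rewrite /centre.
    have [[s Ss sA]|nA] := pselect ([set near (r s) s | s in S] A); first by exists s.
    by exists p => -[].
  apply: (@card_le_II_inj _ _ _ (fun A => c (f A))) => [A _|A B Ap Bp cAB].
    exact: leq_trans (cJ _) (leqnSn _).
  have [SA AE] := fP _ Ap; have [SB BE] := fP _ Bp.
  have [pA rA] : near (half (k p).+1) p (f A) /\ half (k p).+3 <= r (f A).
    by apply: ball_p; rewrite -AE; case: Ap.
  have [pB rB] : near (half (k p).+1) p (f B) /\ half (k p).+3 <= r (f B).
    by apply: ball_p; rewrite -BE; case: Bp.
  (* Centres with the same code are near at a scale below both of their radii, so they coincide by
     separation. *)
  have AB : near (half (k p).+3) (f A) (f B) by apply: cP => //; rewrite four.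
  by rewrite AE BE (sepS (f A) (f B))//; exact: near_le AB.
Qed.

End Refinement.

Theorem dim_le_doubling : dim_le T J.
Proof. by move=> U; exact: doubling_refinement. Qed.

End DoublingDimension.

(** * Uniform bounds and enumerations on finite sets *)

Section FiniteTypes.

Lemma finite_enum (T : Type) : finite_set [set: T] ->
  exists s : seq T, forall x, exists2 i, (i < size s)%N & forall x0, nth x0 s i = x.
Proof.
elim/Pchoice: T => T /finite_seqP[s sE]; exists s => x.
have xs : x \in s by have : [set: T] x by []; rewrite sE.
by exists (index x s) => [|x0]; rewrite ?index_mem ?nth_index.
Qed.

Lemma finite_bound_lt (R : realFieldType) (T : Type) (F : T -> R) e :
  finite_set [set: T] -> (forall x, F x < e) ->
  exists2 e', e' < e & forall x, F x < e'.
Proof.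
move=> /finite_enum[s sP] Fe.
suff [e' e'e e'P] : exists2 e', e' < e &
    forall i x0, (i < size s)%N -> F (nth x0 s i) < e'.
  by exists e' => // x; have [i il ix] := sP x; rewrite -(ix x) e'P.
elim: s {sP} => [|y s [e' e'e IH]]; first by exists (e - 1) => //; rewrite gtrBl.
exists (Num.max e' ((F y + e) / 2)).
  by rewrite gt_max e'e /= -subr_gt0; have := Fe y; lra.
move=> [|i] x0 il; rewrite lt_max /=; last by rewrite IH.
by apply/orP; right; have := Fe y; lra.
Qed.

Lemma finite_bound (R : realFieldType) (T : Type) (F : T -> R) :
  finite_set [set: T] -> exists M, forall x, F x <= M.
Proof.
move=> /finite_enum[s sP].
suff [M MP] : exists M, forall i x0, (i < size s)%N -> F (nth x0 s i) <= M.
  by exists M => x; have [i il ix] := sP x; rewrite -(ix x) MP.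
elim: s {sP} => [|y s [M MP]]; first by exists 0.
exists (Num.max (F y) M) => [[|i] x0 il]; rewrite le_max /= ?lexx//.
by rewrite MP ?orbT.
Qed.

Lemma finite_bound_gt0 (R : realFieldType) (T : Type) (F : T -> R) :
  finite_set [set: T] -> (forall x, 0 < F x) ->
  exists2 e, 0 < e & forall x, e <= F x.
Proof.
move=> Tfin F0; have [|e e0 eP] := @finite_bound_lt R T (fun x => - F x) 0 Tfin.
  by move=> x; rewrite oppr_lt0.
by exists (- e); [rewrite oppr_gt0|move=> x; rewrite lerNl ltW].
Qed.

Lemma finite_surj (T : Type) (x0 : T) : finite_set [set: T] ->
  exists n0, forall n, (n0 <= n)%N ->
  exists g : 'I_n.+1 -> T, forall x, exists i, g i = x.
Proof.
move=> /finite_enum[s sP]; exists (size s) => // n sn.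
exists (fun i => nth x0 s i) => x; have [i il ix] := sP x.
by exists (inord i); rewrite inordK ?ix// ltnS (leq_trans (ltnW il)).
Qed.

End FiniteTypes.

(** * Families of finite weighted metric spaces *)

Lemma ler_close (R : realFieldType) (a b c e : R) :
  `|a - b| < e -> c <= a -> c <= b + e.
Proof. by rewrite ltr_norml => /andP[? ?] ?; lra. Qed.

Section FiniteFamilies.
Variables (R : realType) (T : choiceType) (d : T -> T -> R).
Variables (X : T -> metricSpace R) (w : forall t, X t -> R).
Arguments w {t} _.
Hypothesis X_finite : forall t, finite_set [set: X t].
Hypothesis w_gt0 : forall t (x : X t), 0 < w x.

Definition akin (e : R) (s t : T) := exists f : X s -> X t,
  [/\ bijective f, forall x x' : X s, `|dist (f x) (f x') - dist x x'| < e &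
      forall x : X s, `|w (f x) - w x| < e].

Lemma akin_refl e s : 0 < e -> akin e s s.
Proof.
move=> e0; exists id; split; first by exists id.
  by move=> x x'; rewrite subrr normr0.
by move=> x; rewrite subrr normr0.
Qed.

Lemma akin_sym e s t : akin e s t -> akin e t s.
Proof.
move=> [f [[g fK gK] df wf]]; exists g; split; first by exists f.
  by move=> y y'; rewrite distrC -{1}(gK y) -{1}(gK y').
by move=> y; rewrite distrC -{1}(gK y).
Qed.

Lemma akin_trans e e' s t u :
  akin e s t -> akin e' t u -> akin (e + e') s u.
Proof.
move=> [f [fb df wf]] [g [gb dg wg]]; exists (g \o f); split.
- exact: bij_comp.
- move=> x x' /=; rewrite -(subrK (dist (f x) (f x')) (dist (g _) _)) -addrA addrC.
  by apply: le_lt_trans (ler_normD _ _) _; apply: ltrD.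
- move=> x /=; rewrite -(subrK (w (f x)) (w (g _))) -addrA addrC.
  by apply: le_lt_trans (ler_normD _ _) _; apply: ltrD.
Qed.

Lemma akin_le e e' s t : e <= e' -> akin e s t -> akin e' s t.
Proof.
move=> ee' [f [fb df wf]]; exists f; split=> //.
  by move=> x x'; exact: lt_le_trans ee'.
by move=> x; exact: lt_le_trans ee'.
Qed.

Lemma akin_lt e s t : akin e s t -> exists2 e', e' < e & akin e' s t.
Proof.
move=> [f [fb df wf]].
have [h hP] : exists h, forall x, h x < e /\
    forall x', `|dist (f x) (f x') - dist x x'| < h x.
  suff /choice[h hP] : forall x, exists a, a < e /\
    forall x', `|dist (f x) (f x') - dist x x'| < a by exists h.
  by move=> x; have [a ae aP] := finite_bound_lt (X_finite s) (df x); exists a.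
have [|e1 e1e e1P] := @finite_bound_lt R (X s) h e (X_finite s).
  by move=> x; case: (hP x).
have [e2 e2e e2P] := finite_bound_lt (X_finite s) wf.
exists (Num.max e1 e2); first by rewrite gt_max e1e.
exists f; split=> // [x x'|x]; rewrite lt_max; last by rewrite e2P orbT.
by apply/orP; left; apply: lt_trans (e1P x); case: (hP x) => _; apply.
Qed.

(** The set [F m]; a surjection from ['I_m.+1] leaves room for fewer points. *)
Definition bounded (m : nat) : set T := [set t | exists g : 'I_m.+1 -> X t,
  [/\ forall x, exists i, g i = x,
      forall x x' : X t, x <> x' -> m.+1%:R^-1 <= dist x x' &
      forall x : X t, m.+1%:R^-1 <= w x]].

(** The number of points is read off from a single [s]. Each lower bound on a distance or a weight
    survives up to [e], for every [e]. *)
Lemma akin_bounded m t : (forall e, 0 < e -> exists2 s, bounded m s & akin e s t) ->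
  bounded m t.
Proof.
move=> lim; have [s [g [gs _ _]] [f [[h fK hK] _ _]]] := lim 1 ltr01.
exists (f \o g); split.
- by move=> x; have [i gi] := gs (h x); exists i; rewrite /= gi hK.
- move=> x x' xx'; apply/ler_addgt0Pr => e /lim[s' [_ [_ sep _]]].
  move=> /akin_sym[k [[k' kK _] dk _]].
  have /sep le1 : k x <> k x' by move=> /(can_inj kK).
  exact: ler_close (dk x x') le1.
- move=> x; apply/ler_addgt0Pr => e /lim[s' [_ [_ _ wle]]].
  move=> /akin_sym[k [_ _ wk]].
  exact: ler_close (wk x) (wle _).
Qed.

Lemma bounded_cover : \bigcup_m bounded m = [set: T].
Proof.
rewrite -subTset => t _.
have [n0 surj] := finite_surj (carrier_point (X t)) (X_finite t).
have [e1 e10 e1P] := finite_bound_gt0 (X_finite t) (@w_gt0 t).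
have [e2 e20 e2P] : exists2 e : R, 0 < e & forall x x' : X t, x <> x' -> e <= dist x x'.
  (* The value [1] on the diagonal keeps the minimum over all pairs positive. *)
  pose F (x x' : X t) : R := if pselect (x = x') then 1 else dist x x'.
  have F0 x x' : 0 < F x x'.
    rewrite /F; case: pselect => // xx'; rewrite lt_neqAle.
    apply/andP; split; first by apply/eqP => /esym/dist_eq0.
    exact: mdist_ge0.
  have [h hP] : exists h, forall x, 0 < h x /\ forall x', h x <= F x x'.
    suff /choice[h hP] : forall x, exists a, 0 < a /\ forall x', a <= F x x' by exists h.
    by move=> x; have [a a0 aP] := finite_bound_gt0 (X_finite t) (F0 x); exists a.
  have [|e e0 eP] := @finite_bound_gt0 R (X t) h (X_finite t).
    by move=> x; case: (hP x).
  exists e => // x x' xx'; apply: le_trans (eP x) _.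
  by case: (hP x) => _ /(_ x'); rewrite /F; case: pselect.
pose m := maxn n0 (maxn (Num.bound e1^-1) (Num.bound e2^-1)).
have inv_le (e : R) : 0 < e -> (Num.bound e^-1 <= m)%N -> m.+1%:R^-1 <= e.
  move=> e0 em; rewrite -[leRHS]invrK lef_pV2 ?posrE ?invr_gt0 ?ltr0n//.
  apply/ltW; apply: lt_le_trans (archi_boundP _) _; first by rewrite invr_ge0 ltW.
  by rewrite ler_nat (leq_trans em).
have [g gs] := surj m (leq_maxl _ _).
exists m => //; exists g; split=> // [x x' xx'|x].
  by apply: le_trans (e2P _ _ xx'); apply: inv_le => //; rewrite !leq_max leqnn !orbT.
by apply: le_trans (e1P x); apply: inv_le => //; rewrite !leq_max leqnn !orbT.
Qed.

(** Both [y] and [z] are matched with [p], and the code records the rounded changes of distances and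
    weights. It refers to the points of [p] through [g], so the number of codes depends on [m]
    alone, not on [p] or [r]. *)
Lemma akin_code m (p : T) (r : R) : bounded m p -> 0 < r ->
  exists c : T -> {ffun 'I_m.+1 * 'I_m.+1 -> 'I_8} * {ffun 'I_m.+1 -> 'I_8},
  forall y z, akin (4%:R * r) p y -> akin (4%:R * r) p z -> c y = c z ->
    akin r y z.
Proof.
move=> [g [gs _ _]] r0.
have [f fP] : exists f : forall y, X p -> X y, forall y, akin (4%:R * r) p y ->
   [/\ bijective (f y),
       forall x x', `|dist (f y x) (f y x') - dist x x'| < 4%:R * r &
       forall x, `|w (f y x) - w x| < 4%:R * r].
  pose good y (f : X p -> X y) := akin (4%:R * r) p y ->
   [/\ bijective f, forall x x', `|dist (f x) (f x') - dist x x'| < 4%:R * r &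
       forall x, `|w (f x) - w x| < 4%:R * r].
  suff f y : {f | @good y f} by exists (fun y => sval (f y)) => y; exact: (svalP (f y)).
  apply: cid; have [[f fP]|nf] := pselect (akin (4%:R * r) p y); first by exists f.
  by exists (fun=> carrier_point (X y)) => /nf.
(* The interval from [-4 r] to [4 r] consists of 8 pieces of length [r]; the digit tells which of
   them contains [a]. *)
pose digit (a : R) : 'I_8 := inord (Num.truncn ((a + 4%:R * r) / r)).
have digit_close (a b : R) : `|a| < 4%:R * r -> `|b| < 4%:R * r ->
    digit a = digit b -> `|b - a| < r.
  have digitP (u : R) : `|u| < 4%:R * r ->
      (digit u)%:R * r <= u + 4%:R * r < (digit u)%:R * r + r.
    rewrite ltr_norml => /andP[u1 u2].
    have q0 : 0 <= (u + 4%:R * r) / r by rewrite divr_ge0 ?(ltW r0)//; lra.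
    have /andP[t1 t2] := truncn_itv q0.
    rewrite /digit inordK.
      rewrite -ler_pdivlMr// t1 /= -[X in _ < _ + X]mul1r -mulrDl -ltr_pdivrMr//.
      by rewrite natr1.
    rewrite -(@ltr_nat R); apply: le_lt_trans t1 _.
    rewrite ltr_pdivrMr// [ltRHS](_ : _ = 4%:R * r + 4%:R * r) ?ltrD2r//.
    by rewrite -mulrDl -natrD.
  move=> /digitP aP /digitP bP ab; move: aP bP; rewrite ab.
  move: (_%:R * r) => q; rewrite ltr_norml => /andP[? ?] /andP[? ?].
  by apply/andP; split; lra.
exists (fun y => ([ffun ij => digit (dist (f y (g ij.1)) (f y (g ij.2)) - dist (g ij.1) (g ij.2))],
                  [ffun i => digit (w (f y (g i)) - w (g i))])).
move=> y z /fP[[fy' fyK fyK'] dy wy] /fP[fzb dz wz] [/ffunP cd /ffunP cw].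
exists (f z \o fy'); split.
- by apply: bij_comp => //; exists (f y).
- move=> a b /=; have [i gi] := gs (fy' a); have [j gj] := gs (fy' b).
  have := cd (i, j); rewrite !ffunE /= gi gj => /digit_close.
  move=> /(_ (dy _ _) (dz _ _)); rewrite !fyK'.
  by congr (`| _ | < _); ring.
- move=> a /=; have [i gi] := gs (fy' a).
  have := cw i; rewrite !ffunE /= gi => /digit_close.
  move=> /(_ (wy _) (wz _)); rewrite !fyK'.
  by congr (`| _ | < _); ring.
Qed.

Hypothesis akin_dist : forall x (e : R), 0 < e ->
  exists2 del : R, 0 < del & forall y, akin del x y -> d x y < e.
(** The bound on [y] excludes spaces close to [x] that have more points, such as those in which a
    point of [x] is split into several close ones. *)
Hypothesis dist_akin : forall x m (e : R), 0 < e ->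
  exists2 del : R, 0 < del & forall y, bounded m y -> d x y < del -> akin e x y.

(** By [akin_bounded], a point outside [bounded m] has an [akin]-neighbourhood that misses
    [bounded m]; so [W] contains an [akin]-neighbourhood within [bounded m] of each of its points,
    and [dist_akin] turns it into a [d]-ball. *)
Lemma akin_open m (W : set (dist_space d)) : ~` bounded m `<=` W ->
  (forall x, bounded m x -> W x -> exists2 e, 0 < e &
     forall y, bounded m y -> akin e x y -> W y) -> open W.
Proof.
move=> CW nW; suff : dist_open d W by [].
move=> x Wx.
suff [e e0 eP] : exists2 e : R, 0 < e & forall y, bounded m y -> akin e x y -> W y.
  have [del del0 delP] := dist_akin x m e0; exists del => // y /= xy.
  have [my|/CW//] := pselect (bounded m y).
  by apply: eP => //; exact: delP.
have [mx|nx] := pselect (bounded m x); first exact: nW.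
apply: contrapT => nex; apply: nx; apply: akin_bounded => e e0.
apply: contrapT => nex'; apply: nex; exists e => // y my xy.
by case: nex'; exists y => //; exact: akin_sym.
Qed.

Lemma closed_bounded m : closed (bounded m : set (dist_space d)).
Proof.
rewrite -openC; apply: (@akin_open m) => // x mx; exact.
Qed.

Lemma finite_dimensional_bounded m :
  finite_dimensional (set_type (bounded m : set (dist_space d))).
Proof.
pose near (e : R) (x y : set_type (bounded m : set (dist_space d))) :=
  akin e (val x) (val y).
exists #|{: {ffun 'I_m.+1 * 'I_m.+1 -> 'I_8} * {ffun 'I_m.+1 -> 'I_8}}|.
apply: (@dim_le_doubling R _ near).
- by move=> e x; exact: akin_refl.
- by move=> e x y; exact: akin_sym.
- by move=> e e' x y z; exact: akin_trans.
- by move=> e e' x y; exact: akin_le.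
- by move=> e x y; exact: akin_lt.
- move=> U; split=> [[W oW WU] x Ux|nU].
    have : dist_open d W by [].
    move=> /(_ (val x)) []; first by move: Ux; rewrite -WU.
    move=> e e0 eP; have [del del0 delP] := akin_dist (val x) e0.
    by exists del => // y xy; rewrite -WU; apply: eP; exact: delP.
  (* The largest set with trace [U] on [bounded m], of the form to which [akin_open] applies. *)
  exists ([set x | exists2 y, U y & val y = x] `|` ~` bounded m).
    apply: (@akin_open m); first by move=> x; right.
    move=> x mx [[y Uy yx]|//]; have [e e0 eP] := nU _ Uy.
    exists e => // z mz xz; left; exists (SigSub (mem_set mz)) => //.
    by apply: eP; rewrite /near /= yx.
  apply/seteqP; split=> x /=.
    move=> [[y Uy yx]|]; first by rewrite -(val_inj yx).
    by case; exact: set_valP.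
  by move=> Ux; left; exists x.
- move=> p r r0; have [c cP] := @akin_code m (val p) r (set_valP p) r0.
  pose code (y : set_type (bounded m : set (dist_space d))) : nat :=
    enum_rank (c (val y)).
  exists code; split=> [y|y z py pz cyz]; first exact: ltn_ord.
  by apply: cP => //; apply: enum_rank_inj; exact: val_inj.
Qed.

Theorem strongly_countable_dimensional_family :
  strongly_countable_dimensional (dist_space d).
Proof.
exists bounded; split; [exact: closed_bounded|exact: finite_dimensional_bounded|].
exact: bounded_cover.
Qed.

(** The common weight of the points in the spaces with [k.+1] points to be realized: [1] for the
    Gromov-Hausdorff distance, [1 / (k + 1)] for the box distance. *)
Variable c : nat -> R.
Hypothesis c_gt0 : forall k, 0 < c k.
Hypothesis realize : forall k (D : nat -> nat -> R),
  (forall i, D i i = 0) -> (forall i j, D i j = 0 -> i = j) ->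
  (forall i j, D i j = D j i) -> (forall j i l, D i l <= D i j + D j l) ->
  exists t, exists g : 'I_k.+1 -> X t,
    [/\ bijective g, forall i j, dist (g i) (g j) = D i j & forall i, w (g i) = c k].

(** * Cubes of ultrametric spaces and infinite dimension *)

Section CubeOfSpaces.
Variable D : nat.
Implicit Types x y : 'rV[R]_D.

(** For [x] in the cube, level [i] lies in [[4 i + 1, 4 i + 2]], so levels of different index are at
    least 3 apart, even for different [x]. The default [0] past the last coordinate extends the
    levels to all of [nat], where [realize] takes its metric. *)
Let level x i : R := 4%:R * i%:R + 1 +
  (if i is i'.+1 then oapp (x 0) 0 (insub i' : option 'I_D) else 0).

(* An ultrametric in which the pairs [(0, j.+1)] see the coordinates of [x], on
   scales that are too far apart to be confused. *)
Let cube_dist x i j : R := if i == j then 0 else level x (maxn i j).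

Let level_itv x i : unit_cube x ->
  4%:R * i%:R + 1 <= level x i <= 4%:R * i%:R + 2%:R.
Proof.
move=> Qx; rewrite /level; case: i => [|i]; first by rewrite mulr0; lra.
case: insubP => [j _ _|_] /=; last by lra.
by have /andP[] := Qx j; move: (x 0 j) => u ? ?; apply/andP; split; lra.
Qed.

Let level_le x i j : unit_cube x -> (i <= j)%N -> level x i <= level x j.
Proof.
move=> Qx; rewrite leq_eqVlt => /predU1P[->//|ij].
have /andP[_ le1] := level_itv i Qx; have /andP[le2 _] := level_itv j Qx.
have : i%:R + 1 <= j%:R :> R by rewrite natr1 ler_nat.
by move: le1 le2; move: (level x i) (level x j) (i%:R) (j%:R) => *; lra.
Qed.

Let level_gt0 x i : unit_cube x -> 0 < level x i.
Proof.
move=> Qx; have /andP[le1 _] := level_itv i Qx; apply: lt_le_trans le1.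
by rewrite ltr_wpDl// mulr_ge0 ?ler0n.
Qed.

Let cube_dist_ge0 x i j : unit_cube x -> 0 <= cube_dist x i j.
Proof. by move=> Qx; rewrite /cube_dist; case: eqP => // _; exact/ltW/level_gt0. Qed.

(** Levels increase with the index, and [maxn i l] is at most one of [maxn i j] and [maxn j l]. *)
Let cube_dist_triangle x j i l : unit_cube x ->
  cube_dist x i l <= cube_dist x i j + cube_dist x j l.
Proof.
move=> Qx; have [->|ij] := eqVneq i j.
  by rewrite /cube_dist eqxx add0r.
have [->|jl] := eqVneq j l.
  by rewrite /cube_dist eqxx addr0.
have [->|il] := eqVneq i l.
  by rewrite {1}/cube_dist eqxx addr_ge0 ?cube_dist_ge0.
rewrite /cube_dist (negbTE ij) (negbTE jl) (negbTE il).
case: (leqP (maxn i l) (maxn i j)) => [le|gt].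
  by rewrite -[leLHS]addr0 lerD ?level_le// ltW// level_gt0.
rewrite -[leLHS]add0r lerD ?level_le//; first by rewrite ltW// level_gt0.
rewrite geq_max leq_maxr andbT leqNgt; apply/negP; rewrite gtn_max => /andP[_ li].
by move: gt; rewrite (maxn_idPl (ltnW li)) ltnNge leq_maxl.
Qed.

Definition models x t (g : 'I_D.+1 -> X t) :=
  [/\ bijective g, forall i j, dist (g i) (g j) = cube_dist x i j &
      forall i, w (g i) = c D].

Lemma models_exist : exists phi : 'rV[R]_D -> T,
  forall x, unit_cube x -> exists g : 'I_D.+1 -> X (phi x), models x g.
Proof.
pose good x t := unit_cube x -> exists g : 'I_D.+1 -> X t, models x g.
suff /choice[phi phiP] : forall x, exists t, good x t by exists phi.
move=> x; rewrite /good.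
have ex y : unit_cube y -> exists t, exists g : 'I_D.+1 -> X t, models y g.
  move=> Qy; apply: realize.
  - by move=> i; rewrite /cube_dist eqxx.
  - move=> i j; rewrite /cube_dist; case: eqP => // _ /eqP.
    by rewrite gt_eqF// level_gt0.
  - by move=> i j; rewrite /cube_dist eq_sym maxnC.
  - by move=> j i l; exact: cube_dist_triangle.
have [Qx|nQ] := pselect (unit_cube x); first by have [t tP] := ex x Qx; exists t.
have [|t _] := ex 0; first by move=> j; rewrite mxE lexx ler01.
by exists t => /nQ.
Qed.

Lemma models_akin x y s t (g : 'I_D.+1 -> X s) (h : 'I_D.+1 -> X t) e :
  0 < e -> models x g -> models y h -> cube_close e x y -> akin e s t.
Proof.
move=> e0 [[g' gK gK'] dg wg] [hb dh wh] xy; exists (h \o g'); split.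
- by apply: bij_comp => //; exists g.
- move=> u v /=; rewrite -{2}(gK' u) -{2}(gK' v) dg dh /cube_dist.
  case: eqP => _; first by rewrite subrr normr0.
  rewrite /level opprD addrACA subrr add0r.
  case: maxn => [|i]; first by rewrite subrr normr0.
  case: insubP => [j _ _|_] /=; first by rewrite distrC.
  by rewrite subrr normr0.
- by move=> u /=; rewrite -{2}(gK' u) wg wh subrr normr0.
Qed.

Let level_inj x y i j : unit_cube x -> unit_cube y ->
  `|level y j - level x i| < 1 -> i = j.
Proof.
move=> Qx Qy; have /andP[] := level_itv i Qx; have /andP[] := level_itv j Qy.
move: (level x i) (level y j) => u v v1 v2 u1 u2; rewrite ltr_norml => /andP[uv1 uv2].
apply/eqP; rewrite eqn_leq; apply/andP; split; rewrite -ltnS -(ltr_nat R) -[ltRHS]natr1;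
  by move: (i%:R) (j%:R) u1 u2 v1 v2 => p q *; lra.
Qed.

(** The bijection may permute the indices. As it changes distances by less than 1, it still sends
    the pair [(0, j.+1)] to a pair with larger index [j.+1], and both distances show the coordinate
    [j]. *)
Lemma akin_models x y s t (g : 'I_D.+1 -> X s) (h : 'I_D.+1 -> X t) :
  unit_cube x -> unit_cube y -> models x g -> models y h -> akin 1 s t ->
  forall j, `|x 0 j - y 0 j| < 1.
Proof.
move=> Qx Qy [gb dg wg] [[h' hK hK'] dh wh] [f [fb df _]] j.
pose sigma i := h' (f (g i)).
have sigma_inj : injective sigma.
  by move=> i i' /(can_inj hK')/(bij_inj fb)/(bij_inj gb).
have j0 : ord0 != lift ord0 j by [].
have := df (g ord0) (g (lift ord0 j)).
rewrite -[f (g ord0)]hK' -[f (g (lift _ _))]hK' dg dh.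
rewrite -/(sigma _) -/(sigma _) /cube_dist -[_ == _ :> nat]/(sigma ord0 == sigma (lift ord0 j)).
rewrite (inj_eq sigma_inj) (negbTE j0) /= => close.
have E := level_inj Qx Qy close; move: close; rewrite -E.
rewrite max0n /level /= opprD addrACA subrr add0r distrC.
case: insubP => [k _ kj|]; last by rewrite ltn_ord.
by rewrite /= (_ : k = j)//; apply: val_inj; rewrite /= kj.
Qed.

Lemma models_bounded : exists m, forall x s (g : 'I_D.+1 -> X s),
  unit_cube x -> models x g -> bounded m s.
Proof.
pose m := maxn D (Num.bound (c D)^-1).
have m1 : m.+1%:R^-1 <= 1 :> R by rewrite invf_le1 ?ltr0n// ler1n.
exists m => x s g Qx [[g' gK gK'] dg wg]; exists (g \o inord); split.
- move=> u; exists (inord (g' u)); rewrite /= inordK ?inord_val ?gK'//.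
  by rewrite ltnS (leq_trans _ (leq_maxl _ _))// -ltnS.
- move=> u v uv; rewrite -(gK' u) -(gK' v) dg /cube_dist.
  case: eqP => [E|_].
    by case: uv; rewrite -(gK' u) -(gK' v); congr g; exact: val_inj.
  apply: (le_trans m1); have /andP[le1 _] := level_itv (maxn (g' u) (g' v)) Qx.
  by apply: le_trans le1; rewrite lerDr mulr_ge0 ?ler0n.
- move=> u; rewrite -(gK' u) wg -[leRHS]invrK lef_pV2 ?posrE ?invr_gt0 ?ltr0n//.
  apply/ltW; apply: lt_le_trans (archi_boundP _) _; first by rewrite invr_ge0 ltW.
  by rewrite ler_nat (leq_trans (leq_maxr D _)).
Qed.

End CubeOfSpaces.

Theorem infinite_dimensional_family : infinite_dimensional (dist_space d).
Proof.
(* Order at most [n] allows [n.+1] members at a point, the number that is exceeded in the cube of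
   dimension [n.+1]. *)
move=> [n dimn]; pose D := n.+1.
have [phi phiP] := models_exist D; have [m mP] := models_bounded D.
have phi_bounded x : unit_cube x -> bounded m (phi x).
  by move=> Qx; have [g gP] := phiP x Qx; exact: mP gP.
(* Two elements of [bounded m] in the same [nbhd a] are [1]-akin, which [akin_models] forbids for
   opposite faces. Adding the complement of [bounded m] makes the set open in the whole space. *)
pose nbhd a : set (dist_space d) := [set y | bounded m y -> akin 2^-1 a y].
have nbhd_open a : open (nbhd a).
  apply: (@akin_open m) => [y ny /ny//|x mx /(_ mx) ax].
  have [e' e'lt ax'] := akin_lt ax.
  exists (2^-1 - e'); first by rewrite subr_gt0.
  move=> y my xy _; rewrite -(subrK e' 2^-1) addrC; exact: akin_trans xy.
have [V [[Vo Vc] Vref Vord]] : exists V : set (set (dist_space d)),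
    [/\ open_cover V, refines V [set nbhd a | a in bounded m] & order_le V n].
  apply: dimn; split; first by move=> _ [a _ <-].
  rewrite -subTset => x _; have [mx|nx] := pselect (bounded m x).
    exists (nbhd x); first by exists x.
    by move=> _; apply: akin_refl; rewrite invr_gt0.
  exists (nbhd (phi 0)); last by move=> /nx.
  exists (phi 0) => //; apply: phi_bounded => j.
  by rewrite mxE lexx ler01.
have [|||x Qx] := @lebesgue_covering R D (set (dist_space d)) V (fun A => [set x | A (phi x)]).
- move=> x _; have : [set: dist_space d] (phi x) by [].
  by rewrite -Vc => -[A VA Ax]; exists A.
- move=> A x VA Qx Ax; have : dist_open d A by exact: Vo.
  move=> /(_ _ Ax)[e e0 eA]; have [del del0 delP] := akin_dist (phi x) e0.
  exists del => // y Qy xy; apply: eA; apply: delP.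
  have [g gP] := phiP x Qx; have [h hP] := phiP y Qy.
  exact: models_akin gP hP xy.
- move=> A j x y VA Qx Qy Ax Ay xj yj.
  have [_ [a ma <-] Aa] := Vref A VA.
  have ax := Aa _ Ax (phi_bounded x Qx); have ay := Aa _ Ay (phi_bounded y Qy).
  have xy : akin 1 (phi x) (phi y).
    by rewrite [1]splitr mul1r; exact: akin_trans (akin_sym ax) ay.
  have [g gP] := phiP x Qx; have [h hP] := phiP y Qy.
  have := akin_models Qx Qy gP hP xy j.
  by rewrite xj yj sub0r normrN normr1 ltxx.
by apply; exact: Vord.
Qed.

End FiniteFamilies.

(** * Distortion and models of finite metric spaces *)

Section FiniteMetricSpaces.
Variable R : realType.
Implicit Types X Y : metricSpace R.

Lemma distortion_ge0 X Y (S : set (X * Y)) : (0 <= distortion S)%E.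
Proof. by apply: ereal_sup_ubound; left. Qed.

Lemma distortion_le X Y (S : set (X * Y)) (e : R) : 0 <= e ->
  (forall p q, S p -> S q -> `|dist p.1 q.1 - dist p.2 q.2| <= e) ->
  (distortion S <= e%:E)%E.
Proof.
move=> e0 Se; apply: ge_ereal_sup => _ [->|[p Sp [q Sq <-]]]; first by rewrite lee_fin.
by rewrite lee_fin; exact: Se.
Qed.

Lemma distortion_lt X Y (S : set (X * Y)) (e : R) : (distortion S < e%:E)%E ->
  forall p q, S p -> S q -> `|dist p.1 q.1 - dist p.2 q.2| < e.
Proof.
move=> Se p q Sp Sq; rewrite -lte_fin; apply: le_lt_trans Se.
by apply: ereal_sup_ubound; right; exists p => //; exists q.
Qed.

Lemma distortion_graph X Y (f : X -> Y) (e : R) : 0 <= e ->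
  (forall x x', `|dist (f x) (f x') - dist x x'| <= e) ->
  (distortion [set p | f p.1 = p.2] <= e%:E)%E.
Proof.
move=> e0 fe; apply: distortion_le => // p q /= <- <-.
by rewrite distrC; exact: fe.
Qed.

Lemma finite_diameter X : finite_set [set: X] ->
  exists2 M : R, 0 <= M & forall x x' : X, dist x x' <= M.
Proof.
move=> Xfin.
have [h hP] : exists h : X -> R, forall x x', dist x x' <= h x.
  suff /choice[h hP] : forall x : X, exists a : R, forall x', dist x x' <= a by exists h.
  by move=> x; exact: finite_bound.
have [M MP] := finite_bound h Xfin.
have hM (x x' : X) : dist x x' <= M by apply: le_trans (hP x x') _; exact: MP.
exists M => //; apply: le_trans (hM (carrier_point X) (carrier_point X)).
exact: mdist_ge0.
Qed.

(** Two partners of the same point are at distance less than [e], hence equal, in both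
    directions. *)
Lemma low_distortion_bijective X Y (S : set (X * Y)) (e : R) :
  (forall p q, S p -> S q -> `|dist p.1 q.1 - dist p.2 q.2| < e) ->
  (forall x, exists y, S (x, y)) -> (forall y, exists x, S (x, y)) ->
  (forall x x' : X, x <> x' -> e <= dist x x') ->
  (forall y y' : Y, y <> y' -> e <= dist y y') ->
  exists f : X -> Y, bijective f /\ forall x y, S (x, y) <-> f x = y.
Proof.
move=> Se SX SY eX eY.
have [f fS] := choice SX; have [g gS] := choice SY.
have fun_S x y y' : S (x, y) -> S (x, y') -> y = y'.
  move=> Sy Sy'; apply: contrapT => /eY; have := Se _ _ Sy Sy'.
  rewrite /= distxx sub0r normrN ger0_norm; last exact: mdist_ge0.
  by move=> /lt_le_trans/[apply]; rewrite ltxx.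
have inj_S x x' y : S (x, y) -> S (x', y) -> x = x'.
  move=> Sx Sx'; apply: contrapT => /eX; have := Se _ _ Sx Sx'.
  rewrite /= distxx subr0 ger0_norm; last exact: mdist_ge0.
  by move=> /lt_le_trans/[apply]; rewrite ltxx.
exists f; split; last first.
  by move=> x y; split=> [|<-//]; exact: fun_S.
exists g => [x|y]; first exact: inj_S (gS _) (fS _).
exact: fun_S (fS _) (gS _).
Qed.

Section FiniteModel.
Variables (k : nat) (D : nat -> nat -> R).
Hypothesis Dxx : forall i, D i i = 0.
Hypothesis D_eq0 : forall i j, D i j = 0 -> i = j.
Hypothesis DC : forall i j, D i j = D j i.
Hypothesis D_triangle : forall j i l, D i l <= D i j + D j l.

Let C := {i : nat | (i < k.+1)%N}.

Definition model_point (i : 'I_k.+1) : C := exist _ (val i) (ltn_ord i).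

Lemma model_point_bij : bijective model_point.
Proof.
exists (fun u : C => Ordinal (svalP u)).
  by move=> i; apply: val_inj.
by move=> [i il]; congr exist; exact: bool_irrelevance.
Qed.

Lemma model_finite : finite_set [set: C].
Proof.
have -> : [set: C] = model_point @` [set: 'I_k.+1].
  by apply/esym; rewrite -subTset => u _; have [h _ hK] := model_point_bij; exists (h u).
exact/finite_image/finite_finset.
Qed.

Definition model : metricSpace R.
Proof.
apply: (@MetricSpace R C (fun u v => D (sval u) (sval v))).
- exact: (inhabits (model_point ord0)).
- by move=> u; exact: Dxx.
- by move=> [i il] [j jl] /= /D_eq0 ij; move: il jl; rewrite ij => il jl;
    congr exist; exact: bool_irrelevance.
- by move=> u v; exact: DC.
- by move=> v u t; exact: D_triangle.
Defined.

End FiniteModel.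

End FiniteMetricSpaces.

(** * The Gromov-Hausdorff distance between finite spaces *)

Section GromovHausdorffFinite.
Variable R : realType.

Definition GH_repr (t : set_type (@GHfin R)) : compactMetricSpace R := repr (val t).

Lemma isometric_repr (X : compactMetricSpace R) :
  exists f : X -> repr (\pi_(GHSpace R) X)%qT, onto_isometry f.
Proof.
suff : isometric X (repr (\pi_(GHSpace R) X)%qT) by move/asboolP.
have /eqquotP// :
  (\pi_(GHSpace R) X = \pi_(GHSpace R) (repr (\pi_(GHSpace R) X)))%qT.
by rewrite reprK.
Qed.

Lemma GH_repr_finite t : finite_set [set: GH_repr t].
Proof.
have [X Xfin tE] := set_valP t; rewrite /GH_repr tE.
have [f [_ <-]] := isometric_repr X.
exact: finite_image.
Qed.

Lemma gh_distE (X Y : metricSpace R) : finite_set [set: X] -> finite_set [set: Y] ->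
  exists r, ereal_inf (@distortion R X Y @` @correspondence R X Y) = r%:E /\
            gh_dist X Y = (2^-1 * r)%:E.
Proof.
move=> /finite_diameter[a a0 aP] /finite_diameter[b b0 bP].
set A := @distortion R X Y @` _.
have A0 : (0 <= ereal_inf A)%E.
  by apply: le_ereal_inf_tmp => _ [S _ <-]; exact: distortion_ge0.
have Afin : ereal_inf A \is a fin_num.
  rewrite ge0_fin_numE//; apply: (@le_lt_trans _ _ (a + b)%:E); last exact: ltry.
  apply: ge_ereal_inf; exists (distortion [set: X * Y]).
    exists setT => //; split; rewrite -subTset => x _.
      by exists (x, carrier_point Y).
    by exists (carrier_point X, x).
  apply: distortion_le => [|p q _ _]; first exact: addr_ge0.
  apply: le_trans (ler_normB _ _) _; rewrite !ger0_norm; do ?exact: mdist_ge0.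
  exact: lerD.
by exists (fine (ereal_inf A)); rewrite /gh_dist EFinM fineK.
Qed.

Lemma gh_metric_lt (s t : set_type (@GHfin R)) e :
  gh_metric (val s) (val t) < e ->
  exists2 S, @correspondence R (GH_repr s) (GH_repr t) S & (distortion S < (2%:R * e)%:E)%E.
Proof.
have [r [infE ghE]] := gh_distE (@GH_repr_finite s) (@GH_repr_finite t).
rewrite /gh_metric -/(GH_repr s) -/(GH_repr t) ghE /= => re.
have /ereal_inf_lt[_ [S Sc <-] Se] :
    (ereal_inf (@distortion R (GH_repr s) (GH_repr t) @` @correspondence R _ _) <
     (2%:R * e)%:E)%E.
  by rewrite infE lte_fin; lra.
by exists S.
Qed.

Lemma gh_metric_le (s t : set_type (@GHfin R)) e (f : GH_repr s -> GH_repr t) :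
  0 <= e -> bijective f -> (forall x x', `|dist (f x) (f x') - dist x x'| <= e) ->
  gh_metric (val s) (val t) <= 2^-1 * e.
Proof.
move=> e0 [g fK gK] fe.
have [r [infE ghE]] := gh_distE (@GH_repr_finite s) (@GH_repr_finite t).
rewrite /gh_metric -/(GH_repr s) -/(GH_repr t) ghE /= ler_pM2l ?invr_gt0//.
rewrite -lee_fin -infE; apply: ge_ereal_inf.
exists (distortion [set p | f p.1 = p.2]); last exact: distortion_graph.
exists [set p | f p.1 = p.2] => //; split; rewrite -subTset => x _.
  by exists (x, f x).
by exists (g x, x) => //=.
Qed.

Let w (t : set_type (@GHfin R)) (x : GH_repr t) : R := 1.

Let gh_akin_dist (s : set_type (@GHfin R)) (e : R) : 0 < e ->
  exists2 del : R, 0 < del & forall t, akin w del s t -> gh_metric (val s) (val t) < e.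
Proof.
move=> e0; exists e => // t [f [fb fe _]].
have : gh_metric (val s) (val t) <= 2^-1 * e.
  by apply: (gh_metric_le (ltW e0) fb) => x x'; exact/ltW/fe.
by move=> /le_lt_trans; apply; lra.
Qed.

Let gh_dist_akin (s : set_type (@GHfin R)) m (e : R) : 0 < e ->
  exists2 del : R, 0 < del &
    forall t, bounded w m t -> gh_metric (val s) (val t) < del -> akin w e s t.
Proof.
move=> e0.
have [n _ [_ [_ sep _]]] : (\bigcup_n bounded w n) s.
  by rewrite (bounded_cover GH_repr_finite).
(* Below the separations [1 / (n + 1)] of [s] and [1 / (m + 1)] of [t], a correspondence is the
   graph of a bijection. The radius is [del / 2] because [gh_dist] halves the distortion. *)
pose del := Num.min e (Num.min n.+1%:R^-1 m.+1%:R^-1) : R.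
exists (2^-1 * del).
  by rewrite mulr_gt0 ?invr_gt0// !lt_min e0 !invr_gt0 !ltr0n.
move=> t [_ [_ sept _]] /gh_metric_lt[S [Ss St]].
rewrite mulVKf// => /distortion_lt Sdel.
have [f [fb fS]] : exists f : GH_repr s -> GH_repr t,
    bijective f /\ forall x y, S (x, y) <-> f x = y.
  apply: (low_distortion_bijective Sdel).
  - move=> x; have : [set: GH_repr s] x by [].
    by rewrite -Ss => -[[x' y] Sxy /= <-]; exists y.
  - move=> y; have : [set: GH_repr t] y by [].
    by rewrite -St => -[[x y'] Sxy /= <-]; exists x.
  - by move=> x x' /sep; apply: le_trans; rewrite !ge_min lexx !orbT.
  - by move=> x x' /sept; apply: le_trans; rewrite !ge_min lexx !orbT.
exists f; split=> // [x x'|x]; last by rewrite subrr normr0.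
rewrite distrC; apply: lt_le_trans (Sdel (x, f x) (x', f x') _ _) _; try exact/fS.
by rewrite ge_min lexx.
Qed.

Let gh_realize k (D : nat -> nat -> R) :
  (forall i, D i i = 0) -> (forall i j, D i j = 0 -> i = j) ->
  (forall i j, D i j = D j i) -> (forall j i l, D i l <= D i j + D j l) ->
  exists (t : set_type (@GHfin R)) (g : 'I_k.+1 -> GH_repr t),
    [/\ bijective g, forall i j, dist (g i) (g j) = D i j & forall i, w (g i) = 1].
Proof.
move=> Dxx D0 DC Dt; pose M := model k Dxx D0 DC Dt.
have Mfin : finite_set [set: M] by exact: model_finite.
pose X := @CompactMetricSpace R M (finite_compact Mfin).
have tP : (\pi_(GHSpace R) X)%qT \in @GHfin R.
  by apply/mem_set; exists X.
exists (SigSub tP); have [f fi] := isometric_repr X.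
have [h [_ fK hK]] := isometry_inv fi.
exists (fun i => f (model_point i)); split=> // [|i j].
  by apply: bij_comp; [exists h|exact: model_point_bij].
exact: fi.1.
Qed.

Theorem GHfin_dimension :
  strongly_countable_dimensional (GHfin_space R) /\
  infinite_dimensional (GHfin_space R).
Proof.
split.
  apply: (strongly_countable_dimensional_family GH_repr_finite _ gh_akin_dist gh_dist_akin).
  by move=> t x; rewrite /w.
exact: (infinite_dimensional_family GH_repr_finite gh_akin_dist gh_dist_akin
  (c := fun=> 1) _ gh_realize).
Qed.

End GromovHausdorffFinite.

(** * Probability measures on finite discrete spaces *)

Section FiniteProbability.
Variable R : realType.

Lemma discrete_open (Z : topologicalType) (A : set Z) :
  (forall z : Z, open [set z]) -> open A.
Proof.
move=> Zd; have -> : A = \bigcup_(z in A) [set z] by rewrite bigcup_imset1 image_id.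
by apply: bigcup_open => z _; exact: Zd.
Qed.

Lemma discrete_probability (Z : pointedType) (G : set (set Z)) (I : finType)
    (p : I -> Z) (c : I -> R) :
  (forall i, 0 <= c i) -> \sum_i c i = 1 ->
  exists P : probability (g_sigma_algebraType G) R,
    forall A, P A = (\sum_(i | p i \in A) c i)%:E.
Proof.
move=> c0 c1.
have [mu muE] : exists mu : {measure set (g_sigma_algebraType G) -> \bar R},
    forall A, mu A = (\sum_(i <- enum I | p i \in A) c i)%:E.
  elim: (enum I) => [|i s [mu muE]].
    by exists (mzero : {measure set (g_sigma_algebraType G) -> \bar R}) => A; rewrite big_nil.
  pose nu : {measure set (g_sigma_algebraType G) -> \bar R} :=
    mscale (NngNum (c0 i)) (@dirac _ (g_sigma_algebraType G) (p i) R).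
  exists (measure_add nu mu) => A.
  rewrite -[LHS]/(measure_add nu mu A) measure_addE muE big_cons.
  rewrite -[nu A]/((c i)%:E * @dirac _ (g_sigma_algebraType G) (p i) R A)%E diracE.
  by case: ifP => _; rewrite ?mule1 ?mule0 ?add0e.
have mu1 : mu setT = 1%E.
  by rewrite muE -c1 -big_enum; congr _%:E; apply: eq_bigl => i; rewrite in_setT.
(* The total mass is already 1, so normalizing only supplies the structure of a probability. *)
exists (mnormalize mu (@dirac _ (g_sigma_algebraType G) point R)) => A.
rewrite /= /mnormalize mu1 /= onee_eq0 /= invr1 mule1 muE.
by rewrite big_enum_cond.
Qed.

Lemma finite_bij (T : Type) : finite_set [set: T] ->
  exists n, exists g : 'I_n -> T, bijective g.
Proof.
elim/Pchoice: T => T /finite_seqP[s sE].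
have xs x : x \in undup s by rewrite mem_undup; have : [set: T] x by []; rewrite sE.
exists (size (undup s)), (tnth (in_tuple (undup s))).
have ltx x : (index x (undup s) < size (undup s))%N by rewrite index_mem.
exists (fun x => Ordinal (ltx x)) => [i|x].
  by apply: val_inj; rewrite /= (tnth_nth (tnth (in_tuple (undup s)) i)) index_uniq ?undup_uniq.
by rewrite (tnth_nth x) /= nth_index.
Qed.

Lemma probability_finite (Z : ptopologicalType) n (g : 'I_n -> Z)
    (P : probability (borel Z) R) (A : set (borel Z)) :
  (forall z : Z, open [set z]) -> bijective g ->
  P A = (\sum_(i | g i \in A) fine (P [set g i]))%:E.
Proof.
move=> Zd [g' gK gK'].
have mZ (B : set (borel Z)) : measurable B.
  by apply: sub_sigma_algebra; exact: discrete_open.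
have AE : A = \big[setU/set0]_(i < n | g i \in A) [set g i : borel Z].
  apply/seteqP; split=> z.
    by move=> Az; rewrite (bigD1 (g' z)) /= ?gK' ?inE//; left.
  elim/big_ind : _ => [//|B C BA CA [/BA|/CA]//|i].
  by rewrite inE => Ai ->.
rewrite [in LHS]AE measure_bigsetU_ord//.
  by rewrite -sumEFin; apply: eq_bigr => i _; rewrite fineK// fin_num_measure.
by move=> i j _ _ [z [/= -> /(can_inj gK)]].
Qed.

Lemma finite_open_set1 (X : metricSpace R) (x : X) :
  finite_set [set: X] -> open [set x].
Proof.
move=> Xfin; rewrite -[[set x]]setCK openC.
have /accessible_finite_set_closed : accessible_space X.
  exact/hausdorff_accessible/metric_hausdorff.
by apply; exact: sub_finite_set (@subsetT _ _) Xfin.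
Qed.

Lemma finite_open_set1_prod (X Y : metricSpace R) (z : X * Y) :
  finite_set [set: X] -> finite_set [set: Y] -> open [set z].
Proof.
move=> Xfin Yfin; rewrite openE => _ ->; exists ([set z.1], [set z.2]).
  split; apply: open_nbhs_nbhs; split=> //; exact: finite_open_set1.
by move=> [x y] /= [-> ->]; case: z.
Qed.

End FiniteProbability.

(** * Couplings and the box distance between finite spaces *)

Section FiniteBox.
Variable R : realType.
Implicit Types X Y : mmSpace R.

Definition mass X (x : X) : R := fine (mm_measure X [set (x : borel X)]).

Lemma mass_gt0 X (x : X) : finite_set [set: X] -> 0 < mass x.
Proof.
move=> Xfin; have ox : open [set x] by exact: finite_open_set1.
have := mm_full_support ox (erefl x); rewrite /mass -lte_fin fineK//.
by rewrite fin_num_measure//; exact: sub_sigma_algebra.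
Qed.

Lemma measure_mass X n (g : 'I_n -> X) (A : set (borel X)) : finite_set [set: X] ->
  bijective g -> mm_measure X A = (\sum_(i | g i \in A) mass (g i))%:E.
Proof.
move=> Xfin gb; rewrite (@probability_finite R X n g (mm_measure X) A _ gb)// => x.
exact: finite_open_set1.
Qed.

(* The rest of the mass is coupled independently; if nothing is left then the
   marginals of [M] are already right. *)
Lemma coupling_extend X Y n m (g : 'I_n -> X) (h : 'I_m -> Y) (M : 'I_n -> 'I_m -> R) :
  finite_set [set: X] -> finite_set [set: Y] -> bijective g -> bijective h ->
  (forall i j, 0 <= M i j) ->
  (forall i, \sum_j M i j <= mass (g i)) -> (forall j, \sum_i M i j <= mass (h j)) ->
  exists2 p : probability (borel (X * Y)%type) R, coupling p &
    forall A : set (borel (X * Y)%type),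
      ((\sum_(u | (g u.1, h u.2) \in A) M u.1 u.2)%:E <= p A)%E.
Proof.
move=> Xfin Yfin gb hb M0 Mr Mc.
pose a i := mass (g i) - \sum_j M i j; pose b j := mass (h j) - \sum_i M i j.
pose rest := 1 - \sum_i \sum_j M i j.
have suma : \sum_i a i = rest.
  rewrite sumrB; congr (_ - _); apply: EFin_inj.
  rewrite -(@probability_setT _ _ _ (mm_measure X)) (measure_mass _ _ gb)//.
  by congr _%:E; apply: eq_bigl => i; rewrite in_setT.
have sumb : \sum_j b j = rest.
  rewrite sumrB; congr (_ - _); last exact: exchange_big.
  apply: EFin_inj; rewrite -(@probability_setT _ _ _ (mm_measure Y)) (measure_mass _ _ hb)//.
  by congr _%:E; apply: eq_bigl => i; rewrite in_setT.
have a0 i : 0 <= a i by rewrite subr_ge0.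
have b0 j : 0 <= b j by rewrite subr_ge0.
have rest0 : 0 <= rest by rewrite -suma sumr_ge0.
pose N (u : 'I_n * 'I_m) := M u.1 u.2 + a u.1 * b u.2 / rest.
have Nrow i : \sum_j N (i, j) = mass (g i).
  rewrite big_split /= -mulr_suml -mulr_sumr sumb.
  have [r0|r0] := eqVneq rest 0; last by rewrite mulfK// addrC subrK.
  have := suma; rewrite r0 => /eqP; rewrite psumr_eq0// => /allP/(_ i).
  by rewrite mem_index_enum /a => /(_ isT)/eqP/subr0_eq->; rewrite mulr0 mul0r addr0.
have Ncol j : \sum_i N (i, j) = mass (h j).
  rewrite big_split /= -mulr_suml -mulr_suml suma.
  have [r0|r0] := eqVneq rest 0; last by rewrite mulrAC mulfV// mul1r addrC subrK.
  have := sumb; rewrite r0 => /eqP; rewrite psumr_eq0// => /allP/(_ j).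
  by rewrite mem_index_enum /b => /(_ isT)/eqP/subr0_eq->; rewrite mul0r mul0r addr0.
have N0 u : 0 <= N u by rewrite addr_ge0// divr_ge0// mulr_ge0.
have N1 : \sum_u N u = 1.
  rewrite -(pair_bigA _ (fun i j => N (i, j))) /= (eq_bigr _ (fun i _ => Nrow i)).
  apply: EFin_inj; rewrite -(@probability_setT _ _ _ (mm_measure X)) (measure_mass _ _ gb)//.
  by congr _%:E; apply: eq_bigl => i; rewrite in_setT.
have [p pE] : exists p : probability (borel (X * Y)%type) R,
    forall A, p A = (\sum_(u | (g u.1, h u.2) \in A) N u)%:E.
  pose gh (u : 'I_n * 'I_m) : (X * Y)%type := (g u.1, h u.2).
  exact: (discrete_probability _ gh N0 N1).
exists p; last first.
  move=> A; rewrite pE lee_fin; apply: ler_sum => u _.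
  by rewrite lerDl divr_ge0// mulr_ge0.
split=> A mA; rewrite /pushforward pE.
  rewrite (measure_mass _ _ gb)//; congr _%:E.
  under [RHS]eq_bigr do rewrite -Nrow.
  rewrite pair_big /=; apply: eq_big => [u|[i j] _//].
  by rewrite andbT; apply/idP/idP; rewrite !inE.
rewrite (measure_mass _ _ hb)//; congr _%:E.
under [RHS]eq_bigr do rewrite -Ncol.
rewrite exchange_big /= pair_big /=; apply: eq_big => [u|[i j] _//].
by apply/idP/idP; rewrite !inE.
Qed.

Lemma finite_prod_measurable X Y (A : set (borel (X * Y)%type)) :
  finite_set [set: X] -> finite_set [set: Y] -> measurable A.
Proof.
move=> Xfin Yfin; apply: sub_sigma_algebra; apply: discrete_open => z.
exact: finite_open_set1_prod.
Qed.

Lemma finite_prod_closed X Y (S : set (X * Y)) :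
  finite_set [set: X] -> finite_set [set: Y] -> closed S.
Proof.
move=> Xfin Yfin; rewrite -openC; apply: discrete_open => z.
exact: finite_open_set1_prod.
Qed.

Lemma box_dist_fin_num X Y : finite_set [set: X] -> finite_set [set: Y] ->
  box_dist X Y \is a fin_num.
Proof.
move=> Xfin Yfin; rewrite ge0_fin_numE; last first.
  apply: le_ereal_inf_tmp => _ [[p S] _ <-].
  by rewrite le_max distortion_ge0 orbT.
apply: (@le_lt_trans _ _ 1%E); last exact: ltry.
have [n [g gb]] := finite_bij Xfin; have [m [h hb]] := finite_bij Yfin.
(* For [M = 0] this is the product coupling; with the empty relation it bounds the box distance by
   1. *)
have [|||p pc _] := @coupling_extend X Y n m g h (fun _ _ => 0) Xfin Yfin gb hb.
- by [].
- by move=> i; rewrite big1// ltW// mass_gt0.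
- by move=> j; rewrite big1// ltW// mass_gt0.
apply: ge_ereal_inf; eexists; first by exists (p, set0); [split=> //; exact: closed0|].
rewrite ge_max /= measure0 sube0 lexx /=; apply: (@le_trans _ _ 0%:E); last exact: lee01.
by apply: distortion_le => // p0 q0 [].  
Qed.

Lemma box_dist_lt X Y (e : R) : finite_set [set: X] -> finite_set [set: Y] ->
  fine (box_dist X Y) < e -> exists p : probability (borel (X * Y)%type) R,
    exists2 S, coupling p & (1 - p S < e%:E)%E /\ (distortion S < e%:E)%E.
Proof.
move=> Xfin Yfin; rewrite -lte_fin fineK ?box_dist_fin_num//.
move=> /ereal_inf_lt[_ [[p S] [/= pc _] <-]].
by rewrite gt_max => /andP[pS Se]; exists p, S.
Qed.

(** The smaller of the masses of [x] and [f x] is put on the graph of [f], which loses at most [e]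
    per point. The factor [n.+1] dominates both the lost mass [n e] and the distortion [e]. *)
Lemma box_dist_le X Y n (g : 'I_n -> X) (f : X -> Y) (e : R) :
  finite_set [set: X] -> finite_set [set: Y] -> bijective g -> bijective f ->
  0 <= e -> (forall x x', `|dist (f x) (f x') - dist x x'| <= e) ->
  (forall x, `|mass (f x) - mass x| <= e) -> fine (box_dist X Y) <= n.+1%:R * e.
Proof.
move=> Xfin Yfin gb fb e0 df mf.
rewrite -lee_fin fineK ?box_dist_fin_num//.
pose h i := f (g i); have hb : bijective h by exact: bij_comp.
pose mn i := Num.min (mass (g i)) (mass (h i)).
pose M (i j : 'I_n) := if i == j then mn i else 0.
have mn0 i : 0 <= mn i by rewrite le_min !ltW ?mass_gt0.
have [|||p pc pM] := @coupling_extend X Y n n g h M Xfin Yfin gb hb.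
- by move=> i j; rewrite /M; case: eqP.
- move=> i; rewrite (bigD1 i)//= big1 ?addr0; first by rewrite /M eqxx ge_min lexx.
  by move=> j ji; rewrite /M eq_sym (negbTE ji).
- move=> j; rewrite (bigD1 j)//= big1 ?addr0; first by rewrite /M eqxx ge_min lexx orbT.
  by move=> i ij; rewrite /M (negbTE ij).
pose S : set (X * Y) := [set u | f u.1 = u.2].
have sumM : \sum_(u | (g u.1, h u.2) \in S) M u.1 u.2 = \sum_i mn i.
  rewrite (eq_bigr (fun i => \sum_j M i j)); last first.
    move=> i _; rewrite (bigD1 i)//= big1 ?addr0; first by rewrite /M eqxx.
    by move=> j ji; rewrite /M eq_sym (negbTE ji).
  rewrite pair_bigA /= big_mkcond /=; apply: eq_bigr => -[i j] _ /=.
  case: ifPn => // /negP nS; rewrite /M; case: eqP => // ij.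
  by case: nS; rewrite inE /S /= /h ij.
have pS : ((1 - n%:R * e)%:E <= p S)%E.
  apply: le_trans (pM S); rewrite lee_fin sumM.
  have -> : 1 - n%:R * e = \sum_(i < n) (mass (g i) - e).
    rewrite sumrB sumr_const card_ord mulr_natl; congr (_ - _).
    apply: EFin_inj; rewrite -(@probability_setT _ _ _ (mm_measure X)) (measure_mass _ _ gb)//.
    by congr _%:E; apply: eq_bigl => i; rewrite in_setT.
  apply: ler_sum => i _; rewrite le_min gerBl e0 /=.
  rewrite lerBlDr -lerBlDl; apply: le_trans (ler_norm _) _.
  by rewrite distrC; exact: mf.
apply: ge_ereal_inf; eexists; first by exists (p, S); [split=> //; exact: finite_prod_closed|].
rewrite ge_max /=; apply/andP; split; last first.
  apply: le_trans (distortion_graph e0 df) _.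
  by rewrite lee_fin ler_peMl// ler1n.
rewrite leeBlDr ?fin_num_measure//; last exact: finite_prod_measurable.
apply: (@le_trans _ _ ((n.+1%:R * e)%:E + (1 - n%:R * e)%:E)%E); last exact: leeD2l.
by rewrite -EFinD lee_fin -(natr1 n) (_ : _ + _ = 1 + e) ?lerDl//; ring.
Qed.

End FiniteBox.

(** * The box space of finite metric measure spaces *)

Section BoxFinite.
Variable R : realType.

Definition Box_repr (t : set_type (@Boxfin R)) : mmSpace R := repr (val t).

Lemma mm_isomorphic_repr (X : mmSpace R) :
  exists f : X -> repr (\pi_(BoxSpace R) X)%qT, mm_isomorphism f.
Proof.
suff : mm_isomorphic X (repr (\pi_(BoxSpace R) X)%qT) by move/asboolP.
have /eqquotP// :
  (\pi_(BoxSpace R) X = \pi_(BoxSpace R) (repr (\pi_(BoxSpace R) X)))%qT.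
by rewrite reprK.
Qed.

Lemma Box_repr_finite t : finite_set [set: Box_repr t].
Proof.
have [X Xfin tE] := set_valP t; rewrite /Box_repr tE.
have [f [[_ <-] _]] := mm_isomorphic_repr X.
exact: finite_image.
Qed.

Let w (t : set_type (@Boxfin R)) (x : Box_repr t) : R := mass x.

Let w_gt0 t (x : Box_repr t) : 0 < w x.
Proof. exact/mass_gt0/Box_repr_finite. Qed.

Let box_akin_dist (s : set_type (@Boxfin R)) (e : R) : 0 < e ->
  exists2 del : R, 0 < del & forall t, akin w del s t -> box_metric (val s) (val t) < e.
Proof.
move=> e0; have [n [g gb]] := finite_bij (Box_repr_finite s).
have n0 : 0 < n.+2%:R :> R by rewrite ltr0n.
(* One more than the factor [n.+1] of [box_dist_le], for a strict inequality; [n] depends on [s]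
   only. *)
exists (e / n.+2%:R) => [|t [f [fb df wf]]]; first exact: divr_gt0.
have e'0 : 0 <= e / n.+2%:R by rewrite ltW// divr_gt0.
apply: le_lt_trans (box_dist_le (Box_repr_finite s) (Box_repr_finite t) gb fb e'0
  (fun x x' => ltW (df x x')) (fun x => ltW (wf x))) _.
by rewrite mulrCA gtr_pMr// ltr_pdivrMr// mul1r ltr_nat.
Qed.

Let box_dist_akin (s : set_type (@Boxfin R)) m (e : R) : 0 < e ->
  exists2 del : R, 0 < del &
    forall t, bounded w m t -> box_metric (val s) (val t) < del -> akin w e s t.
Proof.
move=> e0.
have [n _ [_ [_ sep ws]]] : (\bigcup_n bounded w n) s.
  by rewrite (bounded_cover Box_repr_finite).
(* The two inverses bound both the distances and the masses of [s] and [t] from below. *)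
exists (Num.min e (Num.min n.+1%:R^-1 m.+1%:R^-1)).
  by rewrite !lt_min e0 !invr_gt0 !ltr0n.
set del := Num.min _ _.
move=> t [_ [_ sept wt]].
move=> /(box_dist_lt (Box_repr_finite s) (Box_repr_finite t))[p [S [p1 p2] [pS Sdel]]].
have mP (A : set (borel (Box_repr s * Box_repr t)%type)) : measurable A.
  by apply: finite_prod_measurable; exact: Box_repr_finite.
have ms (A : set (borel (Box_repr s))) : measurable A.
  apply: sub_sigma_algebra; apply: discrete_open => x.
  exact/finite_open_set1/Box_repr_finite.
have mt (A : set (borel (Box_repr t))) : measurable A.
  apply: sub_sigma_algebra; apply: discrete_open => x.
  exact/finite_open_set1/Box_repr_finite.
(* Less than [del] of the mass lies outside [S]. *)
have restrict (A : set (borel (Box_repr s * Box_repr t)%type)) :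
    fine (p A) < fine (p (A `&` S)) + del.
  have le1 : (p A <= p (A `&` S) + p (~` S))%E.
    apply: le_trans (measureU2 _ (mP _) (mP _)).
    apply: le_measure; rewrite ?inE//.
    by move=> u Au; have [Su|nSu] := pselect (S u); [left|right].
  rewrite -lte_fin EFinD !fineK ?fin_num_measure//.
  apply: le_lt_trans le1 _; rewrite probability_setC//.
  by apply: lee_ltD => //; rewrite fin_num_measure.
have ps (x : Box_repr s) : mass x = fine (p (fst @^-1` [set x])).
  by rewrite /mass -p1.
have pt (y : Box_repr t) : mass y = fine (p (snd @^-1` [set y])).
  by rewrite /mass -p2.
(* A point without a partner in [S] would have mass less than [del], against the lower bound on
   masses. *)
have [f [fb fS]] : exists f : Box_repr s -> Box_repr t,
    bijective f /\ forall x y, S (x, y) <-> f x = y.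
  apply: (low_distortion_bijective (distortion_lt Sdel)).
  - move=> x; apply: contrapT => nS; have := restrict (fst @^-1` [set x]).
    rewrite -ps (_ : _ `&` _ = set0) ?measure0 ?add0r; last first.
      by rewrite -subset0 => -[x' y] [/= -> Sxy]; apply: nS; exists y.
    apply/negP; rewrite -leNgt; apply: le_trans (ws x).
    by rewrite !ge_min lexx !orbT.
  - move=> y; apply: contrapT => nS; have := restrict (snd @^-1` [set y]).
    rewrite -pt (_ : _ `&` _ = set0) ?measure0 ?add0r; last first.
      by rewrite -subset0 => -[x y'] [/= -> Sxy]; apply: nS; exists x.
    apply/negP; rewrite -leNgt; apply: le_trans (wt y).
    by rewrite !ge_min lexx !orbT.
  - by move=> x x' /sep; apply: le_trans; rewrite !ge_min lexx !orbT.
  - by move=> x x' /sept; apply: le_trans; rewrite !ge_min lexx !orbT.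
have dele : del <= e by rewrite ge_min lexx.
exists f; split=> // [x x'|x].
  rewrite distrC; apply: lt_le_trans dele.
  by apply: (@distortion_lt _ _ _ _ _ Sdel (x, f x) (x', f x')); exact/fS.
have pfine (A B : set (borel (Box_repr s * Box_repr t)%type)) :
    A `<=` B -> fine (p A) <= fine (p B).
  move=> AB; apply: fine_le; rewrite ?fin_num_measure//.
  by apply: le_measure; rewrite ?inE.
(* Inside [S] the fibres over [x] and over [f x] are the same, so the two masses differ by less than
   [del]. *)
apply: lt_le_trans dele; rewrite ltr_norml /w; apply/andP; split.
  rewrite ltrBrDl ltrBlDr ps; apply: lt_le_trans (restrict _) _; rewrite lerD2r pt.
  by apply: pfine => -[x' y] [/= -> /fS].
rewrite ltrBlDl pt; apply: lt_le_trans (restrict _) _; rewrite lerD2r ps.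
by apply: pfine => -[x' y] [/= -> /fS]; exact: (bij_inj fb).
Qed.

Let box_realize k (D : nat -> nat -> R) :
  (forall i, D i i = 0) -> (forall i j, D i j = 0 -> i = j) ->
  (forall i j, D i j = D j i) -> (forall j i l, D i l <= D i j + D j l) ->
  exists (t : set_type (@Boxfin R)) (g : 'I_k.+1 -> Box_repr t),
    [/\ bijective g, forall i j, dist (g i) (g j) = D i j &
        forall i, w (g i) = k.+1%:R^-1].
Proof.
move=> Dxx D0 DC Dt; pose M := model k Dxx D0 DC Dt.
have Mfin : finite_set [set: M] by exact: model_finite.
pose pt (i : 'I_k.+1) : M := model_point i.
have [pt' ptK ptK'] : bijective pt := model_point_bij k.
have [mu muE] : exists mu : probability (borel M) R,
    forall A, mu A = (\sum_(i | pt i \in A) k.+1%:R^-1)%:E.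
  apply: discrete_probability => [i|]; first by rewrite invr_ge0.
  by rewrite sumr_const card_ord -[LHS]mulr_natl mulfV// pnatr_eq0.
have Mcomplete (F : set_system M) : ProperFilter F -> cauchy F -> cvg F.
  move=> PF cF; apply: compact_cauchy_cvg cF _ (finite_compact Mfin).
  exact: filterT.
have Mseparable : exists2 A : set M, countable A & dense A.
  exists setT; first exact: finite_set_countable.
  by move=> U U0 _; rewrite setIT.
have Msupp (x : M) (U : set M) : open U -> U x -> (0 < mu U)%E.
  move=> _ Ux; rewrite muE lte_fin (bigD1 (pt' x)) /= ?ptK' ?inE//.
  by rewrite ltr_wpDr ?invr_gt0 ?ltr0n// sumr_ge0// => i _; rewrite invr_ge0.
pose X := MMSpace Mcomplete Mseparable Msupp.
have tP : (\pi_(BoxSpace R) X)%qT \in @Boxfin R by apply/mem_set; exists X.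
exists (SigSub tP); have [f [fi fmu]] := mm_isomorphic_repr X.
have [h [_ fK hK]] := isometry_inv fi.
exists (fun i => f (pt i)); split=> [|i j|i].
- by apply: bij_comp; [exists h|exists pt'].
- exact: fi.1.
rewrite /w /mass fmu; last first.
  apply: sub_sigma_algebra; apply: finite_open_set1.
  exact: (Box_repr_finite (SigSub tP)).
rewrite /pushforward -[mm_measure X]/mu muE (big_pred1 i)// => j /=.
apply/idP/eqP => [|->]; last by rewrite inE.
by rewrite inE => /(can_inj fK)/(can_inj ptK).
Qed.

Theorem Boxfin_dimension :
  strongly_countable_dimensional (Boxfin_space R) /\
  infinite_dimensional (Boxfin_space R).
Proof.
split.
  exact: (strongly_countable_dimensional_family Box_repr_finite w_gt0 box_akin_dist box_dist_akin).
apply: (infinite_dimensional_family Box_repr_finite box_akin_dist box_dist_akin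
  (c := fun k => k.+1%:R^-1) _ box_realize).
by move=> k; rewrite invr_gt0 ltr0n.
Qed.

End BoxFinite.

Theorem corollary3p9 (R : realType) :
  (strongly_countable_dimensional (GHfin_space R) /\
     infinite_dimensional (GHfin_space R)) /\
  (strongly_countable_dimensional (Boxfin_space R) /\
     infinite_dimensional (Boxfin_space R)).
Proof. by split; [exact: GHfin_dimension|exact: Boxfin_dimension]. Qed.
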